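(* For all $r\in\mathbb{R}$ and all $z$ with $3|z|\sqrt3<2$ we have \[ \mathcal{D}_{3/2,r}(z)=\left(\frac{3}{\left(\sqrt3\cos\beta-\sin\beta\right)^2}\right)^{r}\frac{1}{\cos\beta\left(\cos\beta-\sqrt3\sin\beta\right)}, \] where $\beta=\frac13\arcsin\left(3z\sqrt3/2\right)$.
   Context: For $a\in\mathbb{R}$ and $n\in\{0,1,2,\ldots\}$, $\binom{a}{n}:=a(a-1)\cdots(a-n+1)/n!$ (with $\binom a0=1$). For $p,r\in\mathbb{R}$, $\mathcal{D}_{p,r}(z):=\sum_{n=0}^\infty\binom{np+r}{n}z^n$ (convergent in a neighbourhood of $0$). $\arcsin$ is the principal branch, and the power with exponent $r$ denotes the analytic branch equal to $1$ at $z=0$. *)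

(* Defs.v *)
From Stdlib Require Export Reals Factorial.
From Coquelicot Require Export Coquelicot.

Open Scope R_scope.

Fixpoint falling_factorial (a : R) (n : nat) : R :=
  match n with
  | O => 1
  | S k => falling_factorial a k * (a - INR k)
  end.

Definition gbinom (a : R) (n : nat) : R :=
  falling_factorial a n / INR (fact n).

(* The series D_{p,r} converges at z, with sum l. *)
Definition is_D (p r : R) (z l : C) : Prop :=
  is_pseries (K := C_AbsRing) (V := C_NormedModule)
    (fun n : nat => RtoC (gbinom (INR n * p + r) n)) z l.

Definition Cexp (z : C) : C :=
  (exp (Re z) * cos (Im z), exp (Re z) * sin (Im z)).

Definition Ccos (z : C) : C := ((Cexp (Ci * z) + Cexp (- (Ci * z))) / 2)%C.

Definition Csin (z : C) : C :=
  ((Cexp (Ci * z) - Cexp (- (Ci * z))) / (2 * Ci))%C.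

(* Principal argument, with values in (-PI, PI] for z <> 0. *)
Definition Carg (z : C) : R :=
  if Rle_dec 0 (Im z) then acos (Re z / Cmod z) else - acos (Re z / Cmod z).

(* Principal logarithm; its value at 0 is irrelevant. *)
Definition Clog (z : C) : C := (ln (Cmod z), Carg z).

(* Principal square root: the argument is halved. *)
Definition Csqrt (z : C) : C :=
  (sqrt (Cmod z) * cos (Carg z / 2), sqrt (Cmod z) * sin (Carg z / 2)).

(* Principal branch: arcsin z = -i Log (i z + sqrt (1 - z^2)). *)
Definition Carcsin (z : C) : C :=
  (- (Ci * Clog (Ci * z + Csqrt (1 - z * z))))%C.

Definition holomorphic_on (U : C -> Prop) (f : C -> C) : Prop :=
  forall z : C, U z -> ex_derive (K := C_AbsRing) (V := C_NormedModule) f z.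

(* P is an analytic branch on U of the (a priori multivalued) power g^r:
   P = exp (r L), where L is an analytic branch on U of log g. *)
Definition power_branch (U : C -> Prop) (g : C -> C) (r : R) (P : C -> C)
  : Prop :=
  exists L : C -> C,
    holomorphic_on U L /\
    (forall z : C, U z -> Cexp (L z) = g z) /\
    (forall z : C, U z -> P z = Cexp (r * L z)%C).

Definition disc (z : C) : Prop := 3 * Cmod z * sqrt 3 < 2.

Definition beta (z : C) : C := (/ 3 * Carcsin (3 * z * sqrt 3 / 2))%C.

Definition power_base (z : C) : C :=
  (3 / ((sqrt 3 * Ccos (beta z) - Csin (beta z)) *
        (sqrt 3 * Ccos (beta z) - Csin (beta z))))%C.

(* Main.v *)
(** Let B be the solution of B = 1 + z B^(3/2) with B(0) = 1.  The coefficients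
    of D_{3/2,x} and of B^x satisfy first-order difference equations in x, from
    which the Rothe-Hagen convolution D_{x+y} = D_x B^y follows by polynomiality.
    Since (B^x)' = x D_{x+1/2} = x B^x D_{1/2}, integrating along rays gives
    B^x = exp (x log B), where log B is the power series with derivative D_{1/2}.
    Hence U = B^(-1/2) satisfies U - U^3 = z, D_0 = 2 / (3 U^2 - 1) and
    D_r = B^r D_0.  On the other hand v = cos beta - sin beta / sqrt 3 satisfies
    v - v^3 = z by the triple angle formula.  Both U and v have real part larger
    than 1 / sqrt 3, and the cubic has only one such root on the disc, because
    the product of two such roots and their sum (the opposite of the third one)
    has modulus larger than 2 / (3 sqrt 3).  So U = v. *)
Require Import Defs.
From Stdlib Require Import Lra Lia Psatz Ranalysis5.

(** * Coefficients and their convolution *)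

(** The definition strips the last factor of the product; this recursion strips the first, which is
    what absorption requires. *)
Lemma falling_factorial_shift (a : R) (n : nat) :
  falling_factorial (a + 1) (S n) = (a + 1) * falling_factorial a n.
Proof.
  induction n as [|n IH]; [simpl; ring|].
  change (falling_factorial (a + 1) (S n) * (a + 1 - INR (S n))
          = (a + 1) * (falling_factorial a n * (a - INR n))).
  rewrite IH, S_INR; ring.
Qed.

Lemma INR_fact_pos (n : nat) : 0 < INR (fact n).
Proof. apply lt_0_INR, lt_O_fact. Qed.

Lemma INR_fact_S (n : nat) : INR (fact (S n)) = INR (S n) * INR (fact n).
Proof. now rewrite fact_simpl, mult_INR. Qed.

Lemma INR_S_pos (n : nat) : 0 < INR (S n).
Proof. apply lt_0_INR; lia. Qed.

Lemma gbinom_0 (a : R) : gbinom a 0 = 1.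
Proof. unfold gbinom; simpl; field. Qed.

Lemma gbinom_S (a : R) (n : nat) :
  gbinom a (S n) = gbinom a n * (a - INR n) / INR (S n).
Proof.
  unfold gbinom; rewrite INR_fact_S; simpl falling_factorial.
  pose proof (INR_fact_pos n); pose proof (INR_S_pos n); field; lra.
Qed.

Lemma gbinom_absorb (a : R) (n : nat) :
  INR (S n) * gbinom (a + 1) (S n) = (a + 1) * gbinom a n.
Proof.
  unfold gbinom; rewrite falling_factorial_shift, INR_fact_S.
  pose proof (INR_fact_pos n); pose proof (INR_S_pos n); field; lra.
Qed.

Lemma gbinom_pascal (a : R) (n : nat) :
  gbinom (a + 1) (S n) = gbinom a (S n) + gbinom a n.
Proof.
  pose proof (INR_S_pos n) as Hn.
  apply Rmult_eq_reg_l with (INR (S n)); [|lra].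
  rewrite gbinom_absorb, gbinom_S, S_INR in *; field; lra.
Qed.

Definition D_coef (p x : R) (n : nat) : R := gbinom (INR n * p + x) n.

(* The coefficients of B_p(z)^x, where B = 1 + z B^p and
   D_{p,x} = B^x / (1 - p + p / B). *)
Definition B_coef (p x : R) (n : nat) : R :=
  match n with
  | O => 1
  | S m => x / INR (S m) * D_coef p (x + p - 1) m
  end.

(** Pascal's rule: lowering the index by one takes p away from the upper argument, so x + p appears
    in the second term. As series, D_{x+1} = D_x + z D_{x+p}. *)
Lemma D_coef_diff (p x : R) (n : nat) :
  D_coef p (x + 1) (S n) = D_coef p x (S n) + D_coef p (x + p) n.
Proof.
  unfold D_coef.
  replace (INR (S n) * p + (x + 1)) with (INR (S n) * p + x + 1) by ring.
  rewrite gbinom_pascal; do 2 f_equal; rewrite S_INR; ring.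
Qed.

(** The equation B = 1 + z B^p multiplied by B^x, read coefficientwise. For positive n all three
    terms are multiples of [gbinom y n]. *)
Lemma B_coef_diff (p x : R) (n : nat) :
  B_coef p (x + 1) (S n) = B_coef p x (S n) + B_coef p (x + p) n.
Proof.
  unfold B_coef, D_coef; destruct n as [|n].
  - rewrite !gbinom_0; simpl; field.
  - set (y := INR n * p + (x + p + p - 1)).
    replace (INR (S n) * p + (x + 1 + p - 1)) with (y + 1)
      by (unfold y; rewrite S_INR; ring).
    replace (INR (S n) * p + (x + p - 1)) with y
      by (unfold y; rewrite S_INR; ring).
    pose proof (INR_S_pos n) as Hn; pose proof (INR_S_pos (S n)) as HSn.
    assert (E : gbinom (y + 1) (S n) = (y + 1) * gbinom y n / INR (S n)).
    { apply Rmult_eq_reg_l with (INR (S n)); [|lra].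
      rewrite gbinom_absorb; field; lra. }
    rewrite E, gbinom_S; unfold y; rewrite !S_INR in *; field; lra.
Qed.

Lemma B_coef_0 (p : R) (n : nat) : B_coef p 0 (S n) = 0.
Proof. unfold B_coef; pose proof (INR_S_pos n); field; lra. Qed.

(* Polynomial functions of degree < d, through the factor theorem. *)
Fixpoint poly_fun (d : nat) (f : R -> R) : Prop :=
  match d with
  | O => forall x, f x = 0
  | S d => forall a, exists g, poly_fun d g /\ forall x, f x = f a + (x - a) * g x
  end.

Lemma poly_fun_ext (d : nat) (f g : R -> R) :
  (forall x, f x = g x) -> poly_fun d f -> poly_fun d g.
Proof.
  destruct d; simpl; intros E H.
  - intros x; rewrite <- E; apply H.
  - intros a; destruct (H a) as [h [Hh Eh]]; exists h; split; [exact Hh|].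
    intros x; rewrite <- !E; apply Eh.
Qed.

Lemma poly_fun_S (d : nat) (f : R -> R) : poly_fun d f -> poly_fun (S d) f.
Proof.
  revert f; induction d as [|d IH]; intros f H a.
  - exists (fun _ => 0); split; [now intros ?|].
    intros x; rewrite !H; ring.
  - destruct (H a) as [g [Hg E]]; exists g; split; [apply IH, Hg|exact E].
Qed.

Lemma poly_fun_le (d e : nat) (f : R -> R) :
  (d <= e)%nat -> poly_fun d f -> poly_fun e f.
Proof. induction 1; intros; [assumption|apply poly_fun_S; auto]. Qed.

Lemma poly_fun_lin (d : nat) (f g : R -> R) (c : R) :
  poly_fun d f -> poly_fun d g -> poly_fun d (fun x => f x + c * g x).
Proof.
  revert f g; induction d as [|d IH]; intros f g Hf Hg.
  - intros x; rewrite Hf, Hg; ring.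
  - intros a; destruct (Hf a) as [f' [Hf' Ef]], (Hg a) as [g' [Hg' Eg]].
    exists (fun x => f' x + c * g' x); split; [now apply IH|].
    intros x; rewrite (Ef x), (Eg x); ring.
Qed.

Lemma poly_fun_const (c : R) : poly_fun 1 (fun _ => c).
Proof. intros a; exists (fun _ => 0); split; [now intros ?|intros; ring]. Qed.

Lemma poly_fun_scal (d : nat) (f : R -> R) (c : R) :
  poly_fun d f -> poly_fun d (fun x => c * f x).
Proof.
  intros H; apply poly_fun_ext with (fun x => f x + (c - 1) * f x);
    [intros; ring|now apply poly_fun_lin].
Qed.

Lemma poly_fun_mul_affine (d : nat) (f : R -> R) (c : R) :
  poly_fun d f -> poly_fun (S d) (fun x => (x + c) * f x).
Proof.
  revert f; induction d as [|d IH]; intros f Hf a.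
  - exists (fun _ => 0); split; [now intros ?|].
    intros x; rewrite !Hf; ring.
  - destruct (Hf a) as [g [Hg E]].
    (* From (x + c) f(x) - (a + c) f(a) = (x - a) ((x + c) g(x) + f(a)). *)
    exists (fun x => (x + c) * g x + f a * 1); split.
    + apply (poly_fun_lin (S d) _ (fun _ => 1)).
      * now apply IH.
      * apply poly_fun_le with 1%nat; [lia|apply poly_fun_const].
    + intros x; rewrite (E x); ring.
Qed.

(** The quotient by x - m vanishes on the progression that starts at m + 1, so induction on the
    degree bound applies to it. *)
Lemma poly_fun_eq_0 (d : nat) (f : R -> R) (m : R) :
  poly_fun d f -> (forall k : nat, f (m + INR k) = 0) -> forall x, f x = 0.
Proof.
  revert f m; induction d as [|d IH]; intros f m Hf Hz x; [apply Hf|].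
  destruct (Hf m) as [g [Hg E]].
  assert (Hm : f m = 0) by (rewrite <- (Hz O); f_equal; simpl; ring).
  rewrite E, Hm, (IH g (m + 1) Hg); [ring|].
  intros k; specialize (Hz (S k)); rewrite E, Hm, S_INR in Hz.
  apply Rmult_eq_reg_l with (INR k + 1); [|pose proof (pos_INR k); lra].
  replace (m + 1 + INR k) with (m + (INR k + 1)) by ring.
  replace (m + (INR k + 1) - m) with (INR k + 1) in Hz by ring; lra.
Qed.

Lemma poly_fun_gbinom (n : nat) (c : R) :
  poly_fun (S n) (fun x => gbinom (x + c) n).
Proof.
  induction n as [|n IH].
  - apply poly_fun_ext with (fun _ => 1); [|apply poly_fun_const].
    intros; now rewrite gbinom_0.
  - apply poly_fun_ext with
      (fun x => / INR (S n) * ((x + (c - INR n)) * gbinom (x + c) n)).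
    + intros x; rewrite gbinom_S; unfold Rdiv; ring.
    + now apply poly_fun_scal, poly_fun_mul_affine.
Qed.

Lemma poly_fun_D_coef (p c : R) (n : nat) :
  poly_fun (S n) (fun x => D_coef p (c + x) n).
Proof.
  apply poly_fun_ext with (2 := poly_fun_gbinom n (INR n * p + c)).
  intros x; unfold D_coef; f_equal; ring.
Qed.

Lemma poly_fun_B_coef (p : R) (n : nat) : poly_fun (S n) (fun x => B_coef p x n).
Proof.
  destruct n as [|n].
  - apply poly_fun_ext with (2 := poly_fun_const 1); reflexivity.
  - apply poly_fun_ext with
      (fun x => / INR (S n) * ((x + 0) * D_coef p (p - 1 + x) n)).
    + intros x; unfold B_coef.
      replace (x + p - 1) with (p - 1 + x) by ring; unfold Rdiv; ring.
    + apply poly_fun_scal, poly_fun_mul_affine, poly_fun_D_coef.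
Qed.

Lemma poly_fun_sum (d : nat) (F : nat -> R -> R) (n : nat) :
  (forall k, (k <= n)%nat -> poly_fun d (F k)) ->
  poly_fun d (fun x => sum_f_R0 (fun k => F k x) n).
Proof.
  induction n as [|n IH]; intros H; simpl.
  - apply H; lia.
  - apply poly_fun_ext with
      (fun x => sum_f_R0 (fun k => F k x) n + 1 * F (S n) x); [intros; ring|].
    apply poly_fun_lin; [apply IH; intros; apply H; lia|apply H; lia].
Qed.

(* Rothe-Hagen: the difference of the two sides is a polynomial in y,
   1-periodic by the recurrences in the index n, and it vanishes at y = 0. *)
Lemma D_coef_convolution (p x : R) (n : nat) (y : R) :
  D_coef p (x + y) n = PS_mult (D_coef p x) (B_coef p y) n.
Proof.
  unfold PS_mult; revert y; induction n as [|n IH]; intros y.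
  { simpl; unfold D_coef; rewrite !gbinom_0; ring. }
  set (f := fun y => sum_f_R0 (fun k => D_coef p x k * B_coef p y (S n - k)) (S n)
                     + -1 * D_coef p (x + y) (S n)).
  assert (Hf : forall y, f y = 0); [|specialize (Hf y); unfold f in Hf; lra].
  apply poly_fun_eq_0 with (d := S (S n)) (m := 0).
  { apply poly_fun_lin with (g := fun y => D_coef p (x + y) (S n)); [|apply poly_fun_D_coef].
    apply poly_fun_sum; intros k Hk; apply poly_fun_scal.
    apply poly_fun_le with (S (S n - k)); [lia|apply poly_fun_B_coef]. }
  (* The increments of the two sides under y -> y + 1 agree by the induction hypothesis at y + p.
     The term k = S n is split off, because there the index of [B_coef] is 0 and the recurrence does
     not apply. *)
  assert (Hper : forall y, f (y + 1) = f y).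
  { intros z; unfold f; rewrite <- Rplus_assoc, D_coef_diff, Rplus_assoc, IH, !tech5.
    replace (S n - S n)%nat with O by lia; simpl (B_coef _ _ O).
    rewrite (sum_eq (fun k => D_coef p x k * B_coef p (z + 1) (S n - k))
      (fun k => D_coef p x k * B_coef p z (S n - k)
                + D_coef p x k * B_coef p (z + p) (n - k))).
    2: { intros k Hk; replace (S n - k)%nat with (S (n - k)) by lia.
         rewrite B_coef_diff; ring. }
    rewrite sum_plus; ring. }
  (* Since B^0 = 1, only the term k = S n survives. *)
  assert (H0 : f 0 = 0).
  { unfold f; rewrite tech5, Rplus_0_r.
    replace (S n - S n)%nat with O by lia; simpl (B_coef _ _ O).
    rewrite (sum_eq _ (fun _ => 0)).
    2: { intros k Hk; replace (S n - k)%nat with (S (n - k)) by lia.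
         rewrite B_coef_0; ring. }
    rewrite sum_eq_R0; [ring|reflexivity]. }
  intros k; rewrite Rplus_0_l; induction k as [|k IHk]; [exact H0|].
  now rewrite S_INR, Hper.
Qed.

(** * Growth of the coefficients *)

(** Even and odd indices form two sequences, each eventually nonincreasing. The induction on N drops
    initial terms until the monotonicity holds from the start. *)
Lemma two_step_bounded (b : nat -> R) (N : nat) :
  (forall n, (N <= n)%nat -> b (S (S n)) <= b n) ->
  exists M, forall n, b n <= M.
Proof.
  revert b; induction N as [|N IH]; intros b H.
  - exists (Rmax (b O) (b 1%nat)).
    assert (K : forall n, b n <= Rmax (b O) (b 1%nat)
                       /\ b (S n) <= Rmax (b O) (b 1%nat)); [|apply K].
    induction n as [|n [K1 K2]]; [split; [apply Rmax_l|apply Rmax_r]|].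
    split; [exact K2|].
    apply Rle_trans with (2 := K1), H; lia.
  - destruct (IH (fun n => b (S n))) as [M HM]; [intros; apply H; lia|].
    exists (Rmax (b O) M); intros [|n]; [apply Rmax_l|].
    apply Rle_trans with (2 := Rmax_r _ _), HM.
Qed.

(* A bound on the growth of [a] that makes sum_n a_n z^n converge on [disc]. *)
Definition tame (a : nat -> R) : Prop :=
  forall rho, 0 <= rho -> 3 * rho * sqrt 3 < 2 ->
    exists M, forall n, Rabs (a n) * rho ^ n <= M.

Lemma sqrt3_facts : sqrt 3 * sqrt 3 = 3 /\ 0 < sqrt 3.
Proof. split; [apply sqrt_sqrt|apply sqrt_lt_R0]; lra. Qed.

(** For p = 3/2 a step of two in n raises the upper argument by the integer 3. Two absorptions
    handle two of these units, and [E] the third; the factor n/2 + x + 1 stays on the left because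
    it may vanish. *)
Lemma D_coef_rec (x : R) (n : nat) :
  INR (S n) * INR (S (S n)) * (INR n / 2 + x + 1) * D_coef (3 / 2) x (S (S n)) =
  (3 / 2 * INR n + x + 1) * (3 / 2 * INR n + x + 2) * (3 / 2 * INR n + x + 3)
  * D_coef (3 / 2) x n.
Proof.
  unfold D_coef; set (a := INR n * (3 / 2) + x).
  replace (INR (S (S n)) * (3 / 2) + x) with (a + 1 + 1 + 1)
    by (unfold a; rewrite !S_INR; field).
  assert (E : gbinom (a + 1) n * (a + 1 - INR n) = (a + 1) * gbinom a n).
  { rewrite <- gbinom_absorb, gbinom_S.
    pose proof (INR_S_pos n); field; lra. }
  replace (3 / 2 * INR n + x) with a by (unfold a; ring).
  replace (INR n / 2 + x + 1) with (a + 1 - INR n) by (unfold a; field).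
  transitivity (INR (S n) * (INR (S (S n)) * gbinom (a + 1 + 1 + 1) (S (S n)))
                * (a + 1 - INR n)); [ring|].
  rewrite gbinom_absorb.
  transitivity ((a + 1 + 1 + 1) * (INR (S n) * gbinom (a + 1 + 1) (S n))
                * (a + 1 - INR n)); [ring|].
  rewrite gbinom_absorb.
  transitivity ((a + 1 + 1 + 1) * (a + 1 + 1) *
                (gbinom (a + 1) n * (a + 1 - INR n))); [ring|].
  rewrite E; ring.
Qed.

Lemma Rmult3_le (a b c a' b' c' : R) :
  0 <= a <= a' -> 0 <= b <= b' -> 0 <= c <= c' -> a * b * c <= a' * b' * c'.
Proof.
  intros; apply Rmult_le_compat; try lra; [apply Rmult_le_pos; lra|].
  apply Rmult_le_compat; lra.
Qed.

(** The ratio of the polynomial factors in [D_coef_rec] tends to (3/2)^3 / (1/2) = 27/4. On the disc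
    27/4 rho^2 < 1, so the weighted coefficients eventually do not increase in steps of two. *)
Lemma D_coef_tame (x : R) : tame (D_coef (3 / 2) x).
Proof.
  intros rho Hrho0 Hrho; destruct sqrt3_facts as [Hs Hs0].
  set (q := 27 / 4 * rho ^ 2).
  assert (Hq : 0 <= q < 1).
  { assert (0 <= (3 * rho * sqrt 3)) by (apply Rmult_le_pos; lra).
    unfold q; split; [nra|].
    assert (E : 27 * rho ^ 2 = (3 * rho * sqrt 3) * (3 * rho * sqrt 3)).
    { transitivity (9 * rho ^ 2 * (sqrt 3 * sqrt 3)); [rewrite Hs|]; ring. }
    nra. }
  (* [K] absorbs the lower-order terms: each factor of 2u is at least m - K, and each factor of 8v
     is at most 3 (m + K). The threshold [N] then gives 6 K <= (1 - q) m. *)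
  set (K := 2 * Rabs x + 2).
  assert (HK : 2 <= K) by (unfold K; pose proof (Rabs_pos x); lra).
  destruct (INR_unbounded (6 * K / (1 - q))) as [N HN].
  apply two_step_bounded with N; intros n Hn.
  apply le_INR in Hn; pose proof (D_coef_rec x n) as E.
  rewrite !S_INR in E; set (m := INR n) in *.
  assert (Hm : 6 * K <= (1 - q) * m).
  { apply Rle_trans with ((1 - q) * (6 * K / (1 - q))); [right; field; lra|].
    apply Rmult_le_compat_l; lra. }
  assert (Hm' : 6 * K <= m) by nra.
  assert (Hx : - Rabs x <= x <= Rabs x) by (split; unfold Rabs; destruct Rcase_abs; lra).
  set (u := (m + 1) * (m + 1 + 1) * (m / 2 + x + 1)) in *.
  set (v := (3 / 2 * m + x + 1) * (3 / 2 * m + x + 2) * (3 / 2 * m + x + 3)) in *.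
  assert (Hu : (m - K) ^ 3 <= 2 * u).
  { replace (2 * u) with ((m + 1) * (m + 1 + 1) * (2 * (m / 2 + x + 1)))
      by (unfold u; ring).
    replace ((m - K) ^ 3) with ((m - K) * (m - K) * (m - K)) by ring.
    apply Rmult3_le; unfold K in *; lra. }
  assert (Hv : 8 * v <= 27 * (m + K) ^ 3).
  { replace (8 * v) with ((2 * (3 / 2 * m + x + 1)) * (2 * (3 / 2 * m + x + 2))
       * (2 * (3 / 2 * m + x + 3))) by (unfold v; ring).
    replace (27 * (m + K) ^ 3) with ((3 * (m + K)) * (3 * (m + K)) * (3 * (m + K)))
      by ring.
    apply Rmult3_le; unfold K in *; lra. }
  assert (Hv0 : 0 <= v).
  { unfold v; repeat apply Rmult_le_pos; unfold K in *; lra. }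
  (* Bernoulli: (m - K)^3 >= (1 - 6 K / (m + K)) (m + K)^3 >= q (m + K)^3. *)
  assert (Hqm : q * (m + K) ^ 3 <= (m - K) ^ 3).
  { apply Rle_trans with ((m + K - 6 * K) * (m + K) ^ 2).
    - replace (q * (m + K) ^ 3) with ((q * (m + K)) * (m + K) ^ 2) by ring.
      apply Rmult_le_compat_r; [apply pow2_ge_0|nra].
    - assert (0 <= K ^ 2 * (3 * (m + K) - 2 * K)); [|nra].
      apply Rmult_le_pos; [apply pow2_ge_0|lra]. }
  assert (Hvu : v * rho ^ 2 <= u).
  { assert (rho ^ 2 = 4 / 27 * q) as -> by (unfold q; field).
    assert (8 * v * q <= 27 * (m + K) ^ 3 * q) by (apply Rmult_le_compat_r; lra).
    nra. }
  assert (Hu0 : 0 < u).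
  { unfold u; repeat apply Rmult_lt_0_compat; unfold K in *; lra. }
  apply Rmult_le_reg_l with u; [exact Hu0|].
  replace (u * (Rabs (D_coef (3 / 2) x (S (S n))) * rho ^ S (S n)))
    with (Rabs (u * D_coef (3 / 2) x (S (S n))) * rho ^ 2 * rho ^ n).
  2: { rewrite Rabs_mult, (Rabs_pos_eq u) by lra; simpl; ring. }
  rewrite E, Rabs_mult, (Rabs_pos_eq v) by lra.
  replace (v * Rabs (D_coef (3 / 2) x n) * rho ^ 2 * rho ^ n)
    with (v * rho ^ 2 * (Rabs (D_coef (3 / 2) x n) * rho ^ n)) by ring.
  apply Rmult_le_compat_r; [|exact Hvu].
  apply Rmult_le_pos; [apply Rabs_pos|now apply pow_le].
Qed.

(** The index shift costs only a factor rho, so a series obtained by termwise integration stays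
    tame. *)
Lemma tame_le (a b : nat -> R) (k : R) :
  tame b -> (forall n, Rabs (a (S n)) <= k * Rabs (b n)) -> tame a.
Proof.
  intros Hb H rho H0 H1; destruct (Hb rho H0 H1) as [M HM].
  exists (Rmax (Rabs (a O)) (Rabs k * M * rho)); intros [|n].
  - simpl; rewrite Rmult_1_r; apply Rmax_l.
  - apply Rle_trans with (2 := Rmax_r _ _).
    pose proof (pow_le rho n H0); pose proof (Rabs_pos (b n)).
    apply Rle_trans with (k * Rabs (b n) * rho ^ S n).
    + apply Rmult_le_compat_r; [now apply pow_le|apply H].
    + replace (k * Rabs (b n) * rho ^ S n)
        with (k * (Rabs (b n) * rho ^ n * rho)) by (simpl; ring).
      apply Rle_trans with (Rabs k * (Rabs (b n) * rho ^ n * rho)).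
      * apply Rmult_le_compat_r; [|apply Rle_abs].
        repeat apply Rmult_le_pos; assumption.
      * rewrite (Rmult_assoc _ M); apply Rmult_le_compat_l; [apply Rabs_pos|].
        now apply Rmult_le_compat_r.
Qed.

Lemma Rabs_div_INR_S_le (x : R) (n : nat) : Rabs (x / INR (S n)) <= Rabs x.
Proof.
  pose proof (INR_S_pos n) as Hn; pose proof (Rabs_pos x).
  unfold Rdiv; rewrite Rabs_mult, (Rabs_pos_eq (/ _)).
  2: { left; now apply Rinv_0_lt_compat. }
  rewrite <- (Rmult_1_r (Rabs x)) at 2; apply Rmult_le_compat_l; [assumption|].
  rewrite <- Rinv_1; apply Rinv_le_contravar; [lra|].
  rewrite S_INR; pose proof (pos_INR n); lra.
Qed.

Lemma B_coef_tame (x : R) : tame (B_coef (3 / 2) x).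
Proof.
  apply tame_le with (D_coef (3 / 2) (x + 3 / 2 - 1)) (Rabs x).
  - apply D_coef_tame.
  - intros n; unfold B_coef; rewrite Rabs_mult.
    apply Rmult_le_compat_r; [apply Rabs_pos|apply Rabs_div_INR_S_le].
Qed.

(* The Taylor coefficients of log B_{3/2}. *)
Definition logB_coef (n : nat) : R :=
  match n with
  | O => 0
  | S m => D_coef (3 / 2) (1 / 2) m / INR (S m)
  end.

Lemma logB_coef_tame : tame logB_coef.
Proof.
  apply tame_le with (D_coef (3 / 2) (1 / 2)) 1; [apply D_coef_tame|].
  intros n; rewrite Rmult_1_l; apply Rabs_div_INR_S_le.
Qed.

(** The condition on rho is open, so the tame bound is available at some s rho with s > 1. With rho
    = |z| this gives a radius above 1 in the parameter of the ray through z. *)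
Lemma tame_radius (a : nat -> R) (u : nat -> R) (rho : R) :
  tame a -> 0 <= rho -> 3 * rho * sqrt 3 < 2 ->
  (forall n, Rabs (u n) <= Rabs (a n) * rho ^ n) -> Rbar_lt 1 (CV_radius u).
Proof.
  intros Ha H0 H1 Hu; destruct sqrt3_facts as [Hs Hs0].
  (* s rho stays below 2 / (3 sqrt 3) *)
  set (s := 1 + (2 - 3 * rho * sqrt 3) / 2).
  assert (Hs1 : 1 < s) by (unfold s; lra).
  destruct (Ha (s * rho)) as [M HM].
  - apply Rmult_le_pos; lra.
  - replace (3 * (s * rho) * sqrt 3) with (s * (3 * rho * sqrt 3)) by ring.
    assert (0 <= 3 * rho * sqrt 3) by (apply Rmult_le_pos; lra).
    unfold s; nra.
  - apply Rbar_lt_le_trans with s; [exact Hs1|].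
    apply (CV_radius_bounded u); exists M; intros n.
    apply Rle_trans with (2 := HM n).
    rewrite Rabs_mult, (Rabs_pos_eq (s ^ n)) by (apply pow_le; lra).
    rewrite Rpow_mult_distr, (Rmult_comm (s ^ n)), <- Rmult_assoc.
    apply Rmult_le_compat_r; [apply pow_le; lra|apply Hu].
Qed.

(** * Power series on the disc *)

Notation is_Cseries := (is_series (K := C_AbsRing) (V := C_NormedModule)).

Lemma is_Cseries_unique (u : nat -> C) (l m : C) :
  is_Cseries u l -> is_Cseries u m -> l = m.
Proof. apply (filterlim_locally_unique (V := C_NormedModule)). Qed.

Lemma is_Cseries_ext (u v : nat -> C) (l : C) :
  (forall n, u n = v n) -> is_Cseries u l -> is_Cseries v l.
Proof. apply (is_series_ext (V := C_NormedModule)). Qed.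

Lemma is_Cseries_plus (u v : nat -> C) (l m : C) :
  is_Cseries u l -> is_Cseries v m -> is_Cseries (fun n => (u n + v n)%C) (l + m)%C.
Proof. apply (is_series_plus (V := C_NormedModule)). Qed.

Lemma is_Cseries_scal (c : C) (u : nat -> C) (l : C) :
  is_Cseries u l -> is_Cseries (fun n => (c * u n)%C) (c * l)%C.
Proof. apply (is_series_scal (V := C_NormedModule)). Qed.

Lemma sum_n_C (u : nat -> C) (n : nat) :
  sum_n (G := C_AbelianMonoid) u n
  = (sum_n (fun k => Re (u k)) n, sum_n (fun k => Im (u k)) n).
Proof.
  induction n as [|n IH].
  - rewrite !sum_O; now destruct (u O).
  - rewrite !sum_Sn, IH; now destruct (u (S n)).
Qed.

Lemma is_Cseries_components (u : nat -> C) (l : C) :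
  is_Cseries u l <->
  is_series (fun n => Re (u n)) (Re l) /\ is_series (fun n => Im (u n)) (Im l).
Proof.
  unfold is_series; split; [intros H; split|intros [H1 H2]].
  - apply filterlim_locally; intros eps.
    generalize (proj1 (filterlim_locally _ _) H eps); apply filter_imp.
    intros n Hn; rewrite sum_n_C in Hn; exact (proj1 Hn).
  - apply filterlim_locally; intros eps.
    generalize (proj1 (filterlim_locally _ _) H eps); apply filter_imp.
    intros n Hn; rewrite sum_n_C in Hn; exact (proj2 Hn).
  - apply filterlim_locally; intros eps.
    generalize (filter_and _ _ (proj1 (filterlim_locally _ _) H1 eps)
                  (proj1 (filterlim_locally _ _) H2 eps)); apply filter_imp.
    intros n Hn; rewrite sum_n_C; exact Hn.
Qed.

Lemma is_Cseries_norm_le (u : nat -> C) (v : nat -> R) (l : C) (m : R) :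
  is_Cseries u l -> is_series v m -> (forall n, Cmod (u n) <= v n) -> Cmod l <= m.
Proof.
  intros Hu Hv H.
  apply (filterlim_le (F := eventually)
    (fun n => norm (V := C_NormedModule) (sum_n u n)) (sum_n v) (norm l) m).
  - exists O; intros n _; unfold sum_n.
    apply Rle_trans with (1 := norm_sum_n_m u 0 n).
    apply sum_n_m_le, H.
  - apply filterlim_comp with (1 := Hu), filterlim_norm.
  - exact Hv.
Qed.

(** Built from two real series, so that products and derivatives along rays reduce to real
    analysis. *)
Definition csum (a : nat -> R) (z : C) : C :=
  (Series (fun n => a n * Re (z ^ n)%C), Series (fun n => a n * Im (z ^ n)%C)).

Lemma im_le_Cmod (z : C) : Rabs (Im z) <= Cmod z.
Proof. apply Rle_trans with (2 := Rmax_Cmod z), Rmax_r. Qed.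

Lemma Rabs_coef_le (a : nat -> R) (z : C) (n : nat) (x : R) :
  Rabs x <= Cmod (z ^ n) -> Rabs (a n * x) <= Rabs (a n) * Cmod z ^ n.
Proof.
  intros H; rewrite Rabs_mult, <- Cmod_pow.
  apply Rmult_le_compat_l; [apply Rabs_pos|exact H].
Qed.

Lemma tame_radius_re (a : nat -> R) (z : C) :
  tame a -> disc z -> Rbar_lt 1 (CV_radius (fun n => a n * Re (z ^ n)%C)).
Proof.
  intros Ha Hz; apply tame_radius with (1 := Ha) (rho := Cmod z); auto using Cmod_ge_0.
  intros n; apply Rabs_coef_le, re_le_Cmod.
Qed.

Lemma tame_radius_im (a : nat -> R) (z : C) :
  tame a -> disc z -> Rbar_lt 1 (CV_radius (fun n => a n * Im (z ^ n)%C)).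
Proof.
  intros Ha Hz; apply tame_radius with (1 := Ha) (rho := Cmod z); auto using Cmod_ge_0.
  intros n; apply Rabs_coef_le, im_le_Cmod.
Qed.

Lemma ex_series_Rabs_radius (u : nat -> R) :
  Rbar_lt 1 (CV_radius u) -> ex_series (fun n => Rabs (u n)).
Proof.
  intros H; apply ex_series_ext with (fun n => Rabs (u n * 1 ^ n)).
  - intros n; now rewrite pow1, Rmult_1_r.
  - apply CV_disk_inside; now rewrite Rabs_R1.
Qed.

Lemma ex_series_Rabs_re (a : nat -> R) (z : C) :
  tame a -> disc z -> ex_series (fun n => Rabs (a n * Re (z ^ n)%C)).
Proof. intros; now apply ex_series_Rabs_radius, tame_radius_re. Qed.

Lemma ex_series_Rabs_im (a : nat -> R) (z : C) :
  tame a -> disc z -> ex_series (fun n => Rabs (a n * Im (z ^ n)%C)).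
Proof. intros; now apply ex_series_Rabs_radius, tame_radius_im. Qed.

Lemma Re_mult (z w : C) : Re (z * w)%C = Re z * Re w - Im z * Im w.
Proof. reflexivity. Qed.

Lemma Im_mult (z w : C) : Im (z * w)%C = Re z * Im w + Im z * Re w.
Proof. reflexivity. Qed.

Lemma Re_scal (r : R) (z : C) : Re (r * z)%C = r * Re z.
Proof. destruct z; simpl; ring. Qed.

Lemma Im_scal (r : R) (z : C) : Im (r * z)%C = r * Im z.
Proof. destruct z; simpl; ring. Qed.

Lemma csum_correct (a : nat -> R) (z : C) :
  tame a -> disc z -> is_Cseries (fun n => (RtoC (a n) * z ^ n)%C) (csum a z).
Proof.
  intros Ha Hz; apply is_Cseries_components; split.
  - apply is_series_ext with (fun n => a n * Re (z ^ n)%C).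
    + intros n; now rewrite Re_scal.
    + now apply Series_correct, ex_series_Rabs, ex_series_Rabs_re.
  - apply is_series_ext with (fun n => a n * Im (z ^ n)%C).
    + intros n; now rewrite Im_scal.
    + now apply Series_correct, ex_series_Rabs, ex_series_Rabs_im.
Qed.

Lemma csum_lin (a b c : nat -> R) (k l : R) (z : C) :
  tame a -> tame b -> tame c -> disc z ->
  (forall n, a n = k * b n + l * c n) ->
  csum a z = (k * csum b z + l * csum c z)%C.
Proof.
  intros Ha Hb Hc Hz E.
  apply is_Cseries_unique with (1 := csum_correct a z Ha Hz).
  apply is_Cseries_ext with
    (fun n => k * (b n * z ^ n) + l * (c n * z ^ n))%C.
  - intros n; rewrite E, RtoC_plus, !RtoC_mult; ring.
  - apply is_Cseries_plus; apply is_Cseries_scal; now apply csum_correct.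
Qed.

Lemma tame_scal (a : nat -> R) (k : R) : tame a -> tame (fun n => k * a n).
Proof.
  intros Ha rho H0 H1; destruct (Ha rho H0 H1) as [M HM].
  exists (Rabs k * M); intros n; rewrite Rabs_mult, Rmult_assoc.
  apply Rmult_le_compat_l; [apply Rabs_pos|apply HM].
Qed.

Lemma csum_scal (a : nat -> R) (k : R) (z : C) :
  tame a -> disc z -> csum (fun n => k * a n) z = (k * csum a z)%C.
Proof.
  intros Ha Hz; rewrite (csum_lin _ a a k 0 z); auto using tame_scal.
  - ring.
  - intros n; ring.
Qed.

Lemma csum_shift (a b : nat -> R) (z : C) :
  tame a -> tame b -> disc z -> (forall n, a (S n) = b n) ->
  csum a z = (a O + z * csum b z)%C.
Proof.
  intros Ha Hb Hz E.
  apply is_Cseries_unique with (1 := csum_correct a z Ha Hz).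
  apply (is_series_decr_1 (V := C_NormedModule)).
  apply is_Cseries_ext with (fun n => z * (b n * z ^ n))%C.
  - intros n; rewrite E; simpl; ring.
  - replace (plus _ _) with (z * csum b z)%C.
    + apply is_Cseries_scal; now apply csum_correct.
    + change (z * csum b z = (a O + z * csum b z) + - (a O * 1))%C; ring.
Qed.

(** Four Cauchy products of absolutely convergent real series, recombined through z^n = z^k
    z^(n-k). *)
Lemma csum_mult (a b : nat -> R) (z : C) :
  tame a -> tame b -> disc z -> csum (PS_mult a b) z = (csum a z * csum b z)%C.
Proof.
  intros Ha Hb Hz; unfold csum, Cmult; simpl.
  pose proof (ex_series_Rabs_re a z Ha Hz) as A1.
  pose proof (ex_series_Rabs_im a z Ha Hz) as A2.
  pose proof (ex_series_Rabs_re b z Hb Hz) as B1.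
  pose proof (ex_series_Rabs_im b z Hb Hz) as B2.
  assert (E : forall n k, (k <= n)%nat -> (z ^ n = z ^ k * z ^ (n - k))%C).
  { intros n k H; rewrite <- Cpow_add_r; f_equal; lia. }
  assert (S1 := is_series_mult _ _ _ _ (Series_correct _ (ex_series_Rabs _ A1))
    (Series_correct _ (ex_series_Rabs _ B1)) A1 B1).
  assert (S2 := is_series_mult _ _ _ _ (Series_correct _ (ex_series_Rabs _ A2))
    (Series_correct _ (ex_series_Rabs _ B2)) A2 B2).
  assert (S3 := is_series_mult _ _ _ _ (Series_correct _ (ex_series_Rabs _ A1))
    (Series_correct _ (ex_series_Rabs _ B2)) A1 B2).
  assert (S4 := is_series_mult _ _ _ _ (Series_correct _ (ex_series_Rabs _ A2))
    (Series_correct _ (ex_series_Rabs _ B1)) A2 B1).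
  f_equal; apply is_series_unique.
  - apply is_series_ext with (2 := is_series_minus _ _ _ _ S1 S2).
    intros n; unfold PS_mult.
    match goal with |- plus ?x (opp ?y) = _ => change (plus x (opp y)) with (x - y) end.
    rewrite <- minus_sum, Rmult_comm, scal_sum; apply sum_eq; intros k Hk.
    rewrite (E n k Hk), Re_mult; ring.
  - apply is_series_ext with (2 := is_series_plus _ _ _ _ S3 S4).
    intros n; unfold PS_mult.
    match goal with |- plus ?x ?y = _ => change (plus x y) with (x + y) end.
    rewrite <- sum_plus, Rmult_comm, scal_sum; apply sum_eq; intros k Hk.
    rewrite (E n k Hk), Im_mult; ring.
Qed.

Lemma csum_PSeries (a : nat -> R) (z : C) (t : R) :
  csum a (t * z)%C = (PSeries (fun n => a n * Re (z ^ n)%C) t,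
                      PSeries (fun n => a n * Im (z ^ n)%C) t).
Proof.
  unfold csum, PSeries; f_equal; apply Series_ext; intros n;
    rewrite Cpow_mult_l, <- RtoC_pow.
  - rewrite Re_scal; ring.
  - rewrite Im_scal; ring.
Qed.

Lemma disc_scal (z : C) (t : R) : 0 <= t <= 1 -> disc z -> disc (t * z)%C.
Proof.
  unfold disc; intros Ht Hz; rewrite Cmod_mult, Cmod_R, Rabs_pos_eq by lra.
  pose proof (Cmod_ge_0 z); destruct sqrt3_facts as [_ Hs].
  assert (0 <= 3 * Cmod z * sqrt 3) by (repeat apply Rmult_le_pos; lra).
  replace (3 * (t * Cmod z) * sqrt 3) with (t * (3 * Cmod z * sqrt 3)) by ring.
  nra.
Qed.

(* Derivatives are only needed along rays, where the real and imaginary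
   parts are real power series in the parameter t. *)
Lemma csum_ray_derive (a b : nat -> R) (z : C) (t : R) :
  tame a -> tame b -> disc z -> 0 <= t <= 1 ->
  (forall n, INR (S n) * a (S n) = b n) ->
  is_derive (fun s : R => Re (csum a (s * z)%C)) t (Re (z * csum b (t * z))%C) /\
  is_derive (fun s : R => Im (csum a (s * z)%C)) t (Im (z * csum b (t * z))%C).
Proof.
  intros Ha Hb Hz Ht E.
  assert (S := is_Cseries_scal z _ _
                 (csum_correct b (t * z)%C Hb (disc_scal z t Ht Hz))).
  apply is_Cseries_components in S; destruct S as [S1 S2].
  assert (Ht1 : Rbar_le (Rabs t) 1) by (simpl; rewrite Rabs_pos_eq; lra).
  assert (T : forall n, (z * (b n * (t * z) ^ n) = (b n * t ^ n)%R * z ^ S n)%C).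
  { intros n; rewrite Cpow_mult_l, RtoC_mult, RtoC_pow, Cpow_S; ring. }
  split.
  - apply is_derive_ext with (PSeries (fun n => a n * Re (z ^ n)%C)).
    { intros s; now rewrite csum_PSeries. }
    replace (Re (z * csum b (t * z)))
      with (PSeries (PS_derive (fun n => a n * Re (z ^ n)%C)) t).
    { apply is_derive_PSeries, Rbar_le_lt_trans with (1 := Ht1).
      now apply tame_radius_re. }
    rewrite <- (is_series_unique _ _ S1); unfold PSeries; apply Series_ext.
    intros n; rewrite T, Re_scal; unfold PS_derive; rewrite <- E; ring.
  - apply is_derive_ext with (PSeries (fun n => a n * Im (z ^ n)%C)).
    { intros s; now rewrite csum_PSeries. }
    replace (Im (z * csum b (t * z)))
      with (PSeries (PS_derive (fun n => a n * Im (z ^ n)%C)) t).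
    { apply is_derive_PSeries, Rbar_le_lt_trans with (1 := Ht1).
      now apply tame_radius_im. }
    rewrite <- (is_series_unique _ _ S2); unfold PSeries; apply Series_ext.
    intros n; rewrite T, Im_scal; unfold PS_derive; rewrite <- E; ring.
Qed.

Lemma csum_ray_continuous (a : nat -> R) (z : C) (t : R) :
  tame a -> disc z -> 0 <= t <= 1 ->
  continuity_pt (fun s : R => Re (csum a (s * z)%C)) t /\
  continuity_pt (fun s : R => Im (csum a (s * z)%C)) t.
Proof.
  intros Ha Hz Ht.
  assert (Ht1 : Rbar_le (Rabs t) 1) by (simpl; rewrite Rabs_pos_eq; lra).
  split.
  - apply continuity_pt_ext with (PSeries (fun n => a n * Re (z ^ n)%C)).
    { intros s; now rewrite csum_PSeries. }
    apply PSeries_continuity, Rbar_le_lt_trans with (1 := Ht1).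
    now apply tame_radius_re.
  - apply continuity_pt_ext with (PSeries (fun n => a n * Im (z ^ n)%C)).
    { intros s; now rewrite csum_PSeries. }
    apply PSeries_continuity, Rbar_le_lt_trans with (1 := Ht1).
    now apply tame_radius_im.
Qed.

Lemma csum_0 (a : nat -> R) : csum a 0%C = a O.
Proof.
  replace (RtoC 0) with (0 * 0)%C by ring.
  rewrite csum_PSeries, !PSeries_0; simpl; unfold RtoC; f_equal; ring.
Qed.

(** * The exponential form of the powers of B *)

Lemma Cexp_plus (z w : C) : Cexp (z + w)%C = (Cexp z * Cexp w)%C.
Proof.
  unfold Cexp, Cmult; destruct z as [x y], w as [x' y']; simpl.
  rewrite exp_plus, cos_plus, sin_plus; f_equal; ring.
Qed.

Lemma Cexp_0 : Cexp 0%C = 1%C.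
Proof. unfold Cexp; simpl; rewrite exp_0, cos_0, sin_0; unfold RtoC; f_equal; ring. Qed.

Notation B_sum x := (csum (B_coef (3 / 2) x)).
Notation D_sum x := (csum (D_coef (3 / 2) x)).
Notation logB := (csum logB_coef).

Lemma D_sum_mult (x y : R) (z : C) :
  disc z -> D_sum (x + y) z = (D_sum x z * B_sum y z)%C.
Proof.
  intros Hz; rewrite <- csum_mult; auto using D_coef_tame, B_coef_tame.
  unfold csum; f_equal; apply Series_ext; intros n; now rewrite D_coef_convolution.
Qed.

(* Along a ray both sides solve y' = x z D_{1/2} y, since
   (B^x)' = x D_{x+1/2} = x B^x D_{1/2}. *)
Lemma B_sum_exp (x : R) (z : C) : disc z -> B_sum x z = Cexp (x * logB z)%C.
Proof.
  intros Hz.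
  set (X := fun t : R => Re (B_sum x (t * z)%C)).
  set (Y := fun t : R => Im (B_sum x (t * z)%C)).
  set (u := fun t : R => Re (logB (t * z)%C)).
  set (w := fun t : R => Im (logB (t * z)%C)).
  (* Here d1 + i d2 = z D_{1/2}(t z), the derivative of log B along the ray. *)
  assert (Hd : forall t, 0 <= t <= 1 -> exists d1 d2,
    is_derive X t (x * (d1 * X t - d2 * Y t)) /\
    is_derive Y t (x * (d1 * Y t + d2 * X t)) /\
    is_derive u t d1 /\ is_derive w t d2).
  { intros t Ht.
    destruct (csum_ray_derive (B_coef (3 / 2) x)
      (fun n => x * D_coef (3 / 2) (1 / 2 + x) n) z t)
      as [H1 H2]; auto using B_coef_tame, tame_scal, D_coef_tame.
    { intros n; unfold B_coef; pose proof (INR_S_pos n).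
      replace (x + 3 / 2 - 1) with (1 / 2 + x) by field; field; lra. }
    destruct (csum_ray_derive logB_coef (D_coef (3 / 2) (1 / 2)) z t)
      as [H3 H4]; auto using logB_coef_tame, D_coef_tame.
    { intros n; unfold logB_coef; pose proof (INR_S_pos n); field; lra. }
    rewrite csum_scal, D_sum_mult in H1, H2 by auto using disc_scal, D_coef_tame.
    replace (z * (x * (D_sum (1 / 2) (t * z) * B_sum x (t * z))))%C
      with (x * ((z * D_sum (1 / 2) (t * z)) * B_sum x (t * z)))%C in H1, H2 by ring.
    rewrite Re_scal, Re_mult in H1; rewrite Im_scal, Im_mult in H2.
    do 2 eexists; split; [exact H1|]; split; [exact H2|]; split; [exact H3|exact H4]. }
  assert (H0 : X 0 = 1 /\ Y 0 = 0 /\ u 0 = 0 /\ w 0 = 0).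
  { unfold X, Y, u, w; replace (RtoC 0 * z)%C with (RtoC 0) by ring.
    rewrite !csum_0; simpl; auto. }
  assert (H1 : B_sum x z = (X 1, Y 1) /\ logB z = (u 1, w 1)).
  { unfold X, Y, u, w; replace (RtoC 1 * z)%C with z by ring.
    destruct (B_sum x z), (logB z); auto. }
  destruct H1 as [-> ->]; clearbody X Y u w.
  (* q1 + i q2 = (X + i Y) exp(-x (u + i w)), whose derivative vanishes. *)
  set (q1 := fun t => exp (- (x * u t)) * (X t * cos (x * w t) + Y t * sin (x * w t))).
  set (q2 := fun t => exp (- (x * u t)) * (Y t * cos (x * w t) - X t * sin (x * w t))).
  assert (E1 : q1 0 = q1 1).
  { apply (eq_is_derive (V := R_NormedModule)); [|lra]; intros t Ht.
    destruct (Hd t Ht) as (d1 & d2 & DX & DY & Du & Dw).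
    unfold q1; evar_last.
    - auto_derive; [repeat split; eexists; eassumption|reflexivity].
    - rewrite (is_derive_unique (fun r : R => X r) _ _ DX),
        (is_derive_unique (fun r : R => Y r) _ _ DY),
        (is_derive_unique (fun r : R => u r) _ _ Du),
        (is_derive_unique (fun r : R => w r) _ _ Dw).
      change zero with 0; ring. }
  assert (E2 : q2 0 = q2 1).
  { apply (eq_is_derive (V := R_NormedModule)); [|lra]; intros t Ht.
    destruct (Hd t Ht) as (d1 & d2 & DX & DY & Du & Dw).
    unfold q2; evar_last.
    - auto_derive; [repeat split; eexists; eassumption|reflexivity].
    - rewrite (is_derive_unique (fun r : R => X r) _ _ DX),
        (is_derive_unique (fun r : R => Y r) _ _ DY),
        (is_derive_unique (fun r : R => u r) _ _ Du),
        (is_derive_unique (fun r : R => w r) _ _ Dw).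
      change zero with 0; ring. }
  destruct H0 as (HX & HY & Hu & Hw); unfold q1, q2 in E1, E2.
  rewrite HX, HY, Hu, Hw, Rmult_0_r, Ropp_0, exp_0, cos_0, sin_0 in E1, E2.
  rewrite exp_Ropp in E1, E2.
  pose proof (exp_pos (x * u 1)) as He; pose proof (sin2_cos2 (x * w 1)) as Hsc.
  unfold Rsqr in Hsc; unfold Cexp; rewrite Re_scal, Im_scal; simpl.
  set (e := exp _) in *; set (c := cos _) in *; set (s := sin _) in *.
  assert (F1 : X 1 * c + Y 1 * s = e).
  { apply Rmult_eq_reg_l with (/ e); [rewrite <- E1; field; lra|].
    apply Rinv_neq_0_compat; lra. }
  assert (F2 : Y 1 * c - X 1 * s = 0).
  { apply Rmult_eq_reg_l with (/ e); [rewrite <- E2; ring|].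
    apply Rinv_neq_0_compat; lra. }
  (* [F1] and [F2] give (X 1, Y 1) after a rotation; the rotation is undone with s^2 + c^2 = 1. *)
  f_equal.
  - transitivity (X 1 * (s * s + c * c)); [rewrite Hsc; ring|].
    transitivity ((X 1 * c + Y 1 * s) * c - (Y 1 * c - X 1 * s) * s); [ring|].
    rewrite F1, F2; ring.
  - transitivity (Y 1 * (s * s + c * c)); [rewrite Hsc; ring|].
    transitivity ((X 1 * c + Y 1 * s) * s + (Y 1 * c - X 1 * s) * c); [ring|].
    rewrite F1, F2; ring.
Qed.

(** * Complex differentiability of power series *)

(** The remainders satisfy e_{n+1} = w e_n + (n+1) z^n (w - z)^2. The factor rho^2 on the left
    replaces rho^(n-1) on the right, an exponent that would be negative at n = 0. *)
Lemma pow_taylor_bound (z w : C) (rho : R) (n : nat) :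
  Cmod z <= rho -> Cmod w <= rho ->
  Cmod (w ^ S n - z ^ S n - INR (S n) * z ^ n * (w - z)) * rho ^ 2
  <= INR (S n) * INR n * rho ^ S n * Cmod (w - z) ^ 2.
Proof.
  intros Hz Hw; pose proof (Cmod_ge_0 z); pose proof (Cmod_ge_0 w).
  pose proof (pow2_ge_0 (Cmod (w - z))) as Hh.
  induction n as [|n IH].
  - replace (w ^ 1 - z ^ 1 - INR 1 * z ^ 0 * (w - z))%C with (RtoC 0)
      by (simpl; ring).
    rewrite Cmod_0; simpl (INR 0); lra.
  - replace (w ^ S (S n) - z ^ S (S n) - INR (S (S n)) * z ^ S n * (w - z))%C
      with (w * (w ^ S n - z ^ S n - INR (S n) * z ^ n * (w - z))
            + INR (S n) * z ^ n * (w - z) ^ 2)%C.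
    2: { rewrite (S_INR (S n)), RtoC_plus, !Cpow_S; simpl (_ ^ 2)%C; ring. }
    set (e := (w ^ S n - z ^ S n - INR (S n) * z ^ n * (w - z))%C) in *.
    pose proof (pos_INR n) as Hn; pose proof (INR_S_pos n) as HSn.
    assert (H1 : Cmod (w * e) * rho ^ 2
                 <= rho * (INR (S n) * INR n * rho ^ S n * Cmod (w - z) ^ 2)).
    { rewrite Cmod_mult, Rmult_assoc; apply Rmult_le_compat; auto.
      apply Rmult_le_pos; [apply Cmod_ge_0|apply pow2_ge_0]. }
    assert (H2 : Cmod (INR (S n) * z ^ n * (w - z) ^ 2)
                 <= INR (S n) * rho ^ n * Cmod (w - z) ^ 2).
    { rewrite !Cmod_mult, !Cmod_pow, Cmod_R, Rabs_pos_eq by lra.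
      apply Rmult_le_compat_r; [exact Hh|]; apply Rmult_le_compat_l; [lra|].
      apply pow_incr; lra. }
    apply Rle_trans with ((Cmod (w * e) + Cmod (INR (S n) * z ^ n * (w - z) ^ 2))
                          * rho ^ 2).
    { apply Rmult_le_compat_r; [apply pow2_ge_0|apply Cmod_triangle]. }
    apply Rmult_le_compat_r with (r := rho ^ 2) in H2; [|apply pow2_ge_0].
    apply Rle_trans with (rho * (INR (S n) * INR n * rho ^ S n * Cmod (w - z) ^ 2)
                          + INR (S n) * rho ^ n * Cmod (w - z) ^ 2 * rho ^ 2); [lra|].
    assert (HP : 0 <= INR (S n) * rho ^ S (S n) * Cmod (w - z) ^ 2).
    { apply Rmult_le_pos; [|exact Hh]; apply Rmult_le_pos; [lra|apply pow_le; lra]. }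
    replace (rho * (INR (S n) * INR n * rho ^ S n * Cmod (w - z) ^ 2)
             + INR (S n) * rho ^ n * Cmod (w - z) ^ 2 * rho ^ 2)
      with ((INR n + 1) * (INR (S n) * rho ^ S (S n) * Cmod (w - z) ^ 2))
      by (simpl; ring).
    replace (INR (S (S n)) * INR (S n) * rho ^ S (S n) * Cmod (w - z) ^ 2)
      with (INR (S (S n)) * (INR (S n) * rho ^ S (S n) * Cmod (w - z) ^ 2)) by ring.
    apply Rmult_le_compat_r; [exact HP|]; rewrite !S_INR; lra.
Qed.

Lemma is_C_derive_quadratic (f : C -> C) (z l : C) (d K : R) :
  0 < d ->
  (forall w, Cmod (w - z) < d -> Cmod (f w - f z - (w - z) * l) <= K * Cmod (w - z) ^ 2) ->
  is_derive (K := C_AbsRing) (V := C_NormedModule) f z l.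
Proof.
  intros Hd H; split; [apply is_linear_scal_l|].
  intros x Hx; rewrite <- (is_filter_lim_locally_unique _ _ Hx); clear x Hx.
  intros eps; pose proof (cond_pos eps) as Heps.
  pose proof (Rabs_pos K) as HK.
  assert (Hr : 0 < Rmin d (eps / (Rabs K + 1))).
  { apply Rmin_pos; [exact Hd|apply Rdiv_lt_0_compat; lra]. }
  exists (mkposreal _ Hr); intros w Hw.
  change (Cmod (w - z) < Rmin d (eps / (Rabs K + 1))) in Hw.
  change (Cmod (f w - f z - (w - z) * l) <= eps * Cmod (w - z)).
  pose proof (Cmod_ge_0 (w - z)) as Hh.
  apply Rle_trans with (1 := H w (Rlt_le_trans _ _ _ Hw (Rmin_l _ _))).
  apply Rlt_le_trans with (2 := Rmin_r _ _) in Hw.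
  replace (K * Cmod (w - z) ^ 2) with (K * Cmod (w - z) * Cmod (w - z)) by ring.
  apply Rmult_le_compat_r; [exact Hh|].
  apply Rle_trans with ((Rabs K + 1) * (eps / (Rabs K + 1))); [|right; field; lra].
  apply Rle_trans with (Rabs K * Cmod (w - z)).
  - apply Rmult_le_compat_r; [exact Hh|apply Rle_abs].
  - apply Rmult_le_compat; lra.
Qed.

Lemma disc_widen (z : C) :
  disc z -> exists rho, Cmod z < rho /\ 3 * rho * sqrt 3 < 2.
Proof.
  unfold disc; intros Hz; destruct sqrt3_facts as [Hs Hs0].
  (* A twelfth of the gap, multiplied by 3 sqrt 3, is sqrt 3 / 4 of it, hence less than the whole
     gap. *)
  exists (Cmod z + (2 - 3 * Cmod z * sqrt 3) / 12); split; [lra|].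
  assert (sqrt 3 < 2) by nra.
  replace (3 * (Cmod z + (2 - 3 * Cmod z * sqrt 3) / 12) * sqrt 3)
    with (3 * Cmod z * sqrt 3 + (2 - 3 * Cmod z * sqrt 3) * (sqrt 3 / 4)) by field.
  nra.
Qed.

(** Summing the Taylor remainders of the powers over n bounds the error of the linear approximation
    by a constant times |w - z|^2, uniformly for |w| <= rho. *)
Lemma csum_derive (a b : nat -> R) (z : C) :
  tame a -> tame b -> disc z -> (forall n, INR (S n) * a (S n) = b n) ->
  is_derive (K := C_AbsRing) (V := C_NormedModule) (csum a) z (csum b z).
Proof.
  intros Ha Hb Hz E; destruct (disc_widen z Hz) as (rho & Hrho & Hrho').
  pose proof (Cmod_ge_0 z) as Hz0.
  set (u := fun n => Rabs (a n) * rho ^ n).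
  assert (Hu : Rbar_lt 1 (CV_radius u)).
  { apply tame_radius with (1 := Ha) (rho := rho); [lra|exact Hrho'|].
    intros n; unfold u; rewrite Rabs_pos_eq; [lra|].
    apply Rmult_le_pos; [apply Rabs_pos|apply pow_le; lra]. }
  (* Up to a shift of the index, [v] lists the coefficients of the second derivative of the power
     series of [u]. Its radius also exceeds 1, so it converges at 1. *)
  set (v := fun n => Rabs (a (S n)) * (INR (S n) * INR n * rho ^ S n)).
  assert (Hv : ex_series v).
  { apply ex_series_incr_1.
    apply ex_series_ext with (PS_derive (PS_derive u)).
    - intros n; change (PS_derive (PS_derive u) n = v (S n) :> R).
      unfold PS_derive, u, v; ring.
    - apply ex_series_Rabs, ex_series_Rabs_radius; now rewrite !CV_radius_derive. }
  apply is_C_derive_quadratic with (d := rho - Cmod z) (K := Series v / rho ^ 2); [lra|].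
  intros w Hw.
  assert (Hw' : Cmod w <= rho).
  { replace w with (z + (w - z))%C by ring.
    pose proof (Cmod_triangle z (w - z)%C); lra. }
  assert (Hdw : disc w).
  { unfold disc; destruct sqrt3_facts as [_ Hs].
    apply Rle_lt_trans with (2 := Hrho').
    apply Rmult_le_compat_r; lra. }
  assert (Hp : 0 < rho ^ 2) by (apply pow_lt; lra).
  apply Rmult_le_reg_r with (rho ^ 2); [exact Hp|].
  replace (Series v / rho ^ 2 * Cmod (w - z) ^ 2 * rho ^ 2)
    with (Cmod (w - z) ^ 2 * Series v) by (field; lra).
  assert (Hs : forall y, disc y ->
    is_Cseries (fun n => a (S n) * y ^ S n)%C (csum a y - a O)%C).
  { intros y Hy; apply (is_series_incr_1 (V := C_NormedModule)
                          (fun n => a n * y ^ n)%C).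
    change (is_Cseries (fun n => a n * y ^ n)%C (csum a y - a O + a O * 1)%C).
    replace (csum a y - a O + a O * 1)%C with (csum a y) by ring.
    now apply csum_correct. }
  rewrite <- (Rabs_pos_eq (rho ^ 2)), <- Cmod_R, <- Cmod_mult by lra.
  apply is_Cseries_norm_le with
    (u := fun n => ((rho ^ 2)%R * (a (S n) * w ^ S n + -(1) * (a (S n) * z ^ S n)
                    + - (w - z) * (b n * z ^ n)))%C)
    (v := fun n => Cmod (w - z) ^ 2 * v n).
  - replace ((csum a w - csum a z - (w - z) * csum b z) * (rho ^ 2)%R)%C
      with ((rho ^ 2)%R * ((csum a w - a O) + -(1) * (csum a z - a O)
             + - (w - z) * csum b z))%C by ring.
    apply is_Cseries_scal, is_Cseries_plus; [apply is_Cseries_plus|].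
    + now apply Hs.
    + now apply is_Cseries_scal, Hs.
    + now apply is_Cseries_scal, csum_correct.
  - apply (is_series_scal (V := R_NormedModule)); now apply Series_correct.
  - intros n; unfold v; rewrite <- E, RtoC_mult.
    replace ((rho ^ 2)%R * (a (S n) * w ^ S n + - (1) * (a (S n) * z ^ S n)
               + - (w - z) * (INR (S n) * a (S n) * z ^ n)))%C
      with (a (S n) * ((w ^ S n - z ^ S n - INR (S n) * z ^ n * (w - z)) * (rho ^ 2)%R))%C
      by ring.
    rewrite !Cmod_mult, !Cmod_R, (Rabs_pos_eq (rho ^ 2)) by lra.
    replace (Cmod (w - z) ^ 2 * (Rabs (a (S n)) * (INR (S n) * INR n * rho ^ S n)))
      with (Rabs (a (S n)) * (INR (S n) * INR n * rho ^ S n * Cmod (w - z) ^ 2)) by ring.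
    apply Rmult_le_compat_l; [apply Rabs_pos|].
    apply pow_taylor_bound; lra.
Qed.

Lemma logB_holomorphic : holomorphic_on disc logB.
Proof.
  intros z Hz; exists (D_sum (1 / 2) z).
  apply csum_derive; auto using logB_coef_tame, D_coef_tame.
  intros n; unfold logB_coef; pose proof (INR_S_pos n); field; lra.
Qed.

(** * The cubic equation and its trigonometric root *)

Lemma B_sum_mult (x y : R) (z : C) :
  disc z -> (B_sum x z * B_sum y z)%C = B_sum (x + y) z.
Proof.
  intros Hz; rewrite !B_sum_exp, <- Cexp_plus by exact Hz.
  f_equal; rewrite RtoC_plus; ring.
Qed.

Lemma B_sum_0 (z : C) : disc z -> B_sum 0 z = 1%C.
Proof.
  intros Hz; rewrite B_sum_exp, <- Cexp_0 by exact Hz; f_equal; ring.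
Qed.

Lemma Cmult_eq_reg_l (a z w : C) : a <> 0%C -> (a * z = a * w)%C -> z = w.
Proof.
  intros Ha E; rewrite <- (Cmult_1_l z), <- (Cmult_1_l w), <- (Cinv_l a Ha).
  rewrite <- !Cmult_assoc; now rewrite E.
Qed.

Lemma Ceq (z w : C) : Re z = Re w -> Im z = Im w -> z = w.
Proof. destruct z, w; simpl; intros; now f_equal. Qed.

(* This is B = 1 + z B^{3/2}, divided by B^{3/2}. *)
Lemma B_sum_cubic (z : C) :
  disc z -> (B_sum (- (1 / 2)) z - B_sum (- (1 / 2)) z ^ 3)%C = z.
Proof.
  intros Hz.
  (* The coefficients of B^(-1/2) - B^(-3/2); by the difference equation at x = -3/2 this series is
     z B^0 = z. *)
  set (c := fun n => 1 * B_coef (3 / 2) (- (1 / 2)) n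
                     + (-1) * B_coef (3 / 2) (- (1 / 2) - 1) n).
  assert (Hc : forall n, c (S n) = B_coef (3 / 2) 0 n).
  { intros n; unfold c; replace (- (1 / 2)) with (- (1 / 2) - 1 + 1) at 1 by ring.
    rewrite B_coef_diff; replace (- (1 / 2) - 1 + 3 / 2) with 0 by field; ring. }
  assert (Htc : tame c).
  { apply tame_le with (B_coef (3 / 2) 0) 1; [apply B_coef_tame|].
    intros n; rewrite Hc; lra. }
  assert (E1 := csum_shift c (B_coef (3 / 2) 0) z Htc (B_coef_tame 0) Hz Hc).
  rewrite (csum_lin c (B_coef (3 / 2) (- (1 / 2))) (B_coef (3 / 2) (- (1 / 2) - 1))
    1 (-1) z Htc (B_coef_tame _) (B_coef_tame _) Hz (fun n => eq_refl)), B_sum_0 in E1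
    by exact Hz.
  assert (E2 : (B_sum (- (1 / 2)) z ^ 3)%C = B_sum (- (1 / 2) - 1) z).
  { replace (- (1 / 2) - 1) with (- (1 / 2) + (- (1 / 2) + - (1 / 2))) by field.
    rewrite <- !B_sum_mult by exact Hz; ring. }
  rewrite E2; transitivity (c O + z * 1)%C.
  - rewrite <- E1; replace (RtoC (-1)) with (- (1))%C by (apply Ceq; simpl; ring).
    ring.
  - unfold c, B_coef; replace (1 * 1 + -1 * 1) with 0 by ring; ring.
Qed.

(** Absorption gives D_0 = 3 D_{-1} - 2 coefficientwise, and the convolution gives D_{-1} = D_0
    B^(-1) = D_0 U^2. *)
Lemma D_sum_0 (z : C) :
  disc z -> (D_sum 0 z * (3 * B_sum (- (1 / 2)) z ^ 2 - 1))%C = 2%C.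
Proof.
  intros Hz.
  assert (E : D_sum 0 z = (3 * D_sum (0 + - (1)) z + (-2) * B_sum 0 z)%C).
  { apply csum_lin; auto using D_coef_tame, B_coef_tame.
    intros [|n]; unfold D_coef.
    - rewrite !gbinom_0; simpl; ring.
    - rewrite B_coef_0; set (y := INR (S n) * (3 / 2) + (0 + - (1))).
      replace (INR (S n) * (3 / 2) + 0) with (y + 1) by (unfold y; ring).
      pose proof (INR_S_pos n) as Hn.
      apply Rmult_eq_reg_l with (INR (S n)); [|lra].
      rewrite gbinom_absorb, gbinom_S; unfold y; rewrite S_INR in *; field; lra. }
  rewrite D_sum_mult, B_sum_0 in E by exact Hz.
  assert (E2 : B_sum (- (1)) z = (B_sum (- (1 / 2)) z ^ 2)%C).
  { replace (- (1)) with (- (1 / 2) + - (1 / 2)) by field.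
    rewrite <- B_sum_mult by exact Hz; ring. }
  rewrite E2 in E.
  transitivity (3 * (D_sum 0 z * B_sum (- (1 / 2)) z ^ 2) - D_sum 0 z)%C; [ring|].
  rewrite E at 2; ring.
Qed.

Lemma disc_components (z : C) : disc z <-> 27 * (Re z ^ 2 + Im z ^ 2) < 4.
Proof.
  unfold disc; rewrite <- Cmod2_alt; destruct sqrt3_facts as [Hs Hs0].
  pose proof (Cmod_ge_0 z).
  set (m := 3 * Cmod z * sqrt 3).
  assert (Hm : 0 <= m) by (unfold m; repeat apply Rmult_le_pos; lra).
  assert (E : 27 * Cmod z ^ 2 = m * m).
  { unfold m; transitivity (9 * Cmod z ^ 2 * (sqrt 3 * sqrt 3)); [rewrite Hs|]; ring. }
  rewrite E; split; intros; nra.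
Qed.

(** The bound is the positive zero of 1 - 3 w^2, the derivative of w - w^3. *)
Definition right_of_critical (w : C) : Prop := 1 / sqrt 3 < Re w.

Lemma inv_sqrt3_facts : 1 / sqrt 3 * (1 / sqrt 3) = 1 / 3 /\ 0 < 1 / sqrt 3.
Proof.
  destruct sqrt3_facts as [Hs Hs0]; split.
  - rewrite <- Hs at 3; field; lra.
  - apply Rdiv_lt_0_compat; lra.
Qed.

(* |w| |1 - w| |1 + w| >= 2 / (3 sqrt 3) on the line through the critical
   point 1 / sqrt 3 of w - w^3. *)
Lemma cubic_critical_line (w : C) : disc (w - w ^ 3)%C -> Re w <> 1 / sqrt 3.
Proof.
  rewrite disc_components; destruct w as [x y]; intros H E.
  simpl in E; destruct inv_sqrt3_facts as [Hk Hk0]; rewrite <- E in Hk, Hk0.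
  assert (F : Re ((x, y) - (x, y) ^ 3)%C ^ 2 + Im ((x, y) - (x, y) ^ 3)%C ^ 2
    = (x * x + y ^ 2) * ((1 + x * x + y ^ 2) ^ 2 - 4 * (x * x))) by (simpl; ring).
  (* With x^2 = 1/3 the squared modulus increases with y^2, and its value at y = 0 is 4/27. *)
  rewrite F, Hk in H; pose proof (pow2_ge_0 y); nra.
Qed.

Lemma cubic_unique (v w : C) :
  right_of_critical v -> right_of_critical w ->
  disc (v - v ^ 3)%C -> (v - v ^ 3 = w - w ^ 3)%C -> v = w.
Proof.
  unfold right_of_critical; intros Hv Hw Hd E.
  destruct inv_sqrt3_facts as [Hk Hk0]; set (k := 1 / sqrt 3) in *.
  destruct (Ceq_dec v w) as [|Hne]; [assumption|exfalso].
  assert (Q : (1 - v ^ 2 - v * w - w ^ 2 = 0)%C).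
  { apply Cmult_eq_reg_l with (v - w)%C; [intros H; apply Hne|].
    - replace v with (v - w + w)%C by ring; rewrite H; ring.
    - transitivity ((v - v ^ 3) - (w - w ^ 3))%C; [ring|rewrite E; ring]. }
  (* The third root is -(v + w), so z = v w (v + w). *)
  assert (F : (v - v ^ 3 = v * w * (v + w))%C).
  { transitivity (v * (1 - v ^ 2 - v * w - w ^ 2) + v * w * (v + w))%C; [ring|].
    rewrite Q; ring. }
  unfold disc in Hd; rewrite F, !Cmod_mult in Hd.
  assert (Hre : forall u c, 0 < c -> c < Re u -> c < Cmod u).
  { intros u c H0 H1; apply Rlt_le_trans with (1 := H1).
    apply Rle_trans with (2 := re_le_Cmod u), Rle_abs. }
  pose proof (Hre v k Hk0 Hv) as Mv; pose proof (Hre w k Hk0 Hw) as Mw.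
  assert (Mvw : 2 * k < Cmod (v + w)) by (apply Hre; [lra|simpl; unfold Re in *; lra]).
  destruct sqrt3_facts as [Hs Hs0].
  assert (k * sqrt 3 = 1) by (unfold k; field; lra).
  (* The product of the three moduli exceeds 2 k^3, and 3 sqrt 3 times 2 k^3 is 2, which contradicts
     [Hd]. *)
  assert (k * k < Cmod v * Cmod w) by nra.
  assert (k * k * (2 * k) < Cmod v * Cmod w * Cmod (v + w)) by nra.
  nra.
Qed.

(** Along the ray from 0 to z the real part starts at 1 > 1 / sqrt 3, varies continuously, and
    cannot meet the critical line by [cubic_critical_line]. *)
Lemma B_sum_right (z : C) : disc z -> right_of_critical (B_sum (- (1 / 2)) z).
Proof.
  intros Hz; unfold right_of_critical; destruct inv_sqrt3_facts as [Hk Hk0].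
  set (k := 1 / sqrt 3) in *.
  set (f := fun t : R => Re (B_sum (- (1 / 2)) (t * z)%C) - k).
  assert (H0 : 0 < f 0).
  { unfold f; replace (RtoC 0 * z)%C with (RtoC 0) by ring.
    rewrite csum_0; simpl; nra. }
  assert (Hne : forall t, 0 <= t <= 1 -> f t <> 0).
  { intros t Ht Hft; pose proof (disc_scal z t Ht Hz) as Hd.
    apply (cubic_critical_line (B_sum (- (1 / 2)) (t * z)%C)).
    - now rewrite B_sum_cubic.
    - fold k; unfold f in Hft; lra. }
  assert (H1 : 0 < f 1).
  { destruct (Rlt_or_le 0 (f 1)) as [|H]; [assumption|exfalso].
    destruct (IVT_interv (fun t => - f t) 0 1) as [t [Ht Hft]]; try lra.
    - intros t Ht; apply continuity_pt_opp, continuity_pt_minus.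
      + exact (proj1 (csum_ray_continuous _ z t (B_coef_tame _) Hz Ht)).
      + apply continuity_pt_const; now intros ??.
    - assert (f 1 <> 0) by (apply Hne; lra); lra.
    - apply (Hne t Ht); lra. }
  unfold f in H1; replace (RtoC 1 * z)%C with z in H1 by ring; lra.
Qed.

(** * Principal argument, square root and arcsine *)

Lemma Carg_spec (z : C) :
  Cmod z * cos (Carg z) = Re z /\ Cmod z * sin (Carg z) = Im z /\ - PI <= Carg z <= PI.
Proof.
  (* At 0 the quotient inside [acos] is meaningless, but both products vanish with the modulus and
     the range of [acos] still gives the bounds. *)
  destruct (Ceq_dec z 0%C) as [->|Hz].
  { rewrite Cmod_0; simpl; repeat split; try ring; unfold Carg;
      destruct Rle_dec; pose proof (acos_bound (Re 0 / Cmod 0)); lra. }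
  apply Cmod_gt_0 in Hz; pose proof (Cmod2_alt z) as E.
  assert (Hb : -1 <= Re z / Cmod z <= 1).
  { pose proof (re_le_Cmod z) as H; apply Rabs_le_between in H; split.
    - apply Rle_div_r; lra.
    - apply Rle_div_l; lra. }
  assert (Hc : Cmod z * cos (acos (Re z / Cmod z)) = Re z).
  { rewrite cos_acos by exact Hb; field; lra. }
  assert (Hs : Cmod z * sin (acos (Re z / Cmod z)) = Rabs (Im z)).
  { rewrite sin_acos by exact Hb.
    rewrite <- (Rabs_pos_eq (Cmod z)) at 1 by lra.
    rewrite <- sqrt_Rsqr_abs, <- sqrt_mult_alt, <- sqrt_Rsqr_abs by apply Rle_0_sqr.
    f_equal; unfold Rsqr.
    transitivity (Cmod z ^ 2 - Re z ^ 2); [field; lra|rewrite E; ring]. }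
  pose proof (acos_bound (Re z / Cmod z)) as Hab.
  unfold Carg; destruct Rle_dec as [Hi|Hi].
  - rewrite Hc, Hs, Rabs_pos_eq by exact Hi; repeat split; lra.
  - rewrite cos_neg, sin_neg, Hc; replace (Cmod z * - sin (acos (Re z / Cmod z)))
      with (- (Cmod z * sin (acos (Re z / Cmod z)))) by ring.
    rewrite Hs, Rabs_left by lra; repeat split; lra.
Qed.

Lemma Cexp_Clog (z : C) : z <> 0%C -> Cexp (Clog z) = z.
Proof.
  intros Hz; apply Cmod_gt_0 in Hz; destruct (Carg_spec z) as (H1 & H2 & _).
  unfold Cexp, Clog; apply Ceq; simpl; now rewrite exp_ln.
Qed.

Lemma Csqrt_sqr (z : C) : (Csqrt z * Csqrt z)%C = z.
Proof.
  destruct (Carg_spec z) as (H1 & H2 & _).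
  pose proof (sqrt_sqrt _ (Cmod_ge_0 z)) as Hs.
  set (h := Carg z / 2) in *.
  replace (Carg z) with (2 * h) in H1, H2 by (unfold h; field).
  rewrite cos_2a in H1; rewrite sin_2a in H2.
  unfold Csqrt; fold h; set (q := sqrt (Cmod z)) in *; rewrite <- Hs in H1, H2.
  apply Ceq; [rewrite <- H1|rewrite <- H2]; simpl; ring.
Qed.

Lemma Csqrt_re_nonneg (z : C) : 0 <= Re (Csqrt z).
Proof.
  destruct (Carg_spec z) as (_ & _ & H); simpl.
  apply Rmult_le_pos; [apply sqrt_pos|apply cos_ge_0; lra].
Qed.

(* The argument of Log in the definition of arcsin. *)
Definition arcsin_arg (z : C) : C := (Ci * z + Csqrt (1 - z * z))%C.

(** With s^2 = 1 - z^2, the product (s + i z)(s - i z) is s^2 + z^2. *)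
Lemma arcsin_arg_inv (z : C) :
  (arcsin_arg z * (Csqrt (1 - z * z) - Ci * z))%C = 1%C.
Proof.
  unfold arcsin_arg.
  transitivity (Csqrt (1 - z * z) * Csqrt (1 - z * z) - Ci * Ci * z * z)%C; [ring|].
  rewrite Csqrt_sqr; apply Ceq; destruct z; simpl; ring.
Qed.

(** For z = x + i y and the square root a + i b, the real part is a - y. From a^2 - b^2 = 1 - x^2 +
    y^2 and x^2 < 1 follows a^2 > y^2, while a >= 0. *)
Lemma arcsin_arg_re (z : C) : Cmod z < 1 -> 0 < Re (arcsin_arg z).
Proof.
  intros Hz; pose proof (Cmod_ge_0 z).
  assert (Hm : Re z ^ 2 + Im z ^ 2 < 1) by (rewrite <- Cmod2_alt; nra).
  pose proof (Csqrt_re_nonneg (1 - z * z)%C) as Ha.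
  pose proof (Csqrt_sqr (1 - z * z)%C) as E.
  unfold arcsin_arg; set (s := Csqrt _) in *; clearbody s.
  destruct z as [x y], s as [a b]; simpl in *; injection E as E1 E2.
  assert (E3 : a * b = - (x * y)) by lra.
  assert (E4 : a * a - b * b = 1 - x * x + y * y) by lra.
  assert (Ha2 : y * y < a * a).
  { destruct (Rlt_or_le (y * y) (a * a)) as [|Hc]; [assumption|exfalso].
    assert ((a * a) * (b * b) = (x * x) * (y * y)).
    { transitivity ((a * b) * (a * b)); [ring|rewrite E3; ring]. }
    nra. }
  nra.
Qed.

Lemma Carg_right (z : C) : 0 < Re z -> - (PI / 2) < Carg z < PI / 2.
Proof.
  intros Hz; destruct (Carg_spec z) as (H1 & _ & H2).
  pose proof PI_RGT_0; pose proof (Cmod_ge_0 z).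
  split; apply Rnot_le_lt; intros Hc.
  - assert (cos (Carg z) <= 0); [|nra].
    rewrite <- cos_neg; apply cos_le_0; lra.
  - assert (cos (Carg z) <= 0) by (apply cos_le_0; lra); nra.
Qed.

Lemma Ci_sqr : (Ci * Ci)%C = (- (1))%C.
Proof. apply Ceq; simpl; ring. Qed.

Lemma Cexp_mul_opp (z : C) : (Cexp z * Cexp (- z))%C = 1%C.
Proof. rewrite <- Cexp_plus, <- Cexp_0; f_equal; ring. Qed.

(** This form keeps [Ci] out of the denominators, so that [field] together with [Ci_sqr] suffices
    later. *)
Lemma Csin_alt (z : C) :
  Csin z = (- Ci * (Cexp (Ci * z) - Cexp (- (Ci * z))) / 2)%C.
Proof.
  unfold Csin; apply Cmult_eq_reg_l with (2 * Ci)%C.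
  - intros H; injection H; simpl; lra.
  - transitivity (- (Ci * Ci) * (Cexp (Ci * z) - Cexp (- (Ci * z))))%C.
    + rewrite Ci_sqr; field; intros H; injection H; lra.
    + field.
Qed.

Lemma Ccos_Csin_sqr (z : C) : (Ccos z ^ 2 + Csin z ^ 2)%C = 1%C.
Proof.
  rewrite Csin_alt; unfold Ccos; rewrite <- (Cexp_mul_opp (Ci * z)%C).
  set (e := Cexp (Ci * z)); set (f := Cexp (- (Ci * z))).
  transitivity ((e + f) ^ 2 / 4 + (e - f) ^ 2 * (Ci * Ci) / 4)%C; [field|].
  rewrite Ci_sqr; field.
Qed.

Lemma Cexp_cube (z : C) : (Cexp (/ 3 * z) ^ 3)%C = Cexp z.
Proof.
  transitivity (Cexp (/ 3 * z + (/ 3 * z + / 3 * z)))%C.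
  - rewrite !Cexp_plus; ring.
  - f_equal; field.
Qed.

(** Let e = exp(i arcsin(x) / 3) and f = 1/e. Then e^3 = sqrt(1 - x^2) + i x and f^3 = sqrt(1 - x^2)
    - i x, and the left side is (e^3 - f^3) / (2 i). The only fact on branches involved is exp(Log
    w) = w. *)
Lemma Csin_triple_arcsin (x : C) :
  Cmod x < 1 ->
  (3 * Csin (/ 3 * Carcsin x) - 4 * Csin (/ 3 * Carcsin x) ^ 3)%C = x.
Proof.
  intros Hx; pose proof (arcsin_arg_re x Hx) as Hre.
  pose proof (arcsin_arg_inv x) as Hinv.
  assert (Hw : arcsin_arg x <> 0%C).
  { intros H; rewrite H in Hre; simpl in Hre; lra. }
  assert (HL : (Ci * (/ 3 * Carcsin x) = / 3 * Clog (arcsin_arg x))%C).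
  { unfold Carcsin; fold (arcsin_arg x).
    transitivity (/ 3 * (- (Ci * Ci) * Clog (arcsin_arg x)))%C; [ring|].
    rewrite Ci_sqr; ring. }
  rewrite Csin_alt, HL.
  pose proof (Cexp_cube (Clog (arcsin_arg x))) as He3.
  pose proof (Cexp_mul_opp (/ 3 * Clog (arcsin_arg x))%C) as Hef.
  rewrite Cexp_Clog in He3 by exact Hw.
  set (e := Cexp (/ 3 * _)) in *; set (f := Cexp (- _)) in *.
  assert (Hf3 : (f ^ 3 = Csqrt (1 - x * x) - Ci * x)%C).
  { apply Cmult_eq_reg_l with (1 := Hw); rewrite Hinv, <- He3.
    transitivity ((e * f) ^ 3)%C; [ring|rewrite Hef; ring]. }
  transitivity (- Ci * (3 * (e - f) - (Ci * Ci) * (e - f) ^ 3) / 2)%C; [field|].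
  rewrite Ci_sqr.
  transitivity (- Ci * (e ^ 3 - f ^ 3 + 3 * (e - f) * (1 - e * f)) / 2)%C; [field|].
  rewrite Hef, He3, Hf3; unfold arcsin_arg.
  transitivity (- (Ci * Ci) * x)%C; [field|rewrite Ci_sqr; ring].
Qed.

(** * The trigonometric root of the cubic *)

Lemma cosh_ge_1 (y : R) : 2 <= exp y + exp (- y).
Proof.
  pose proof (exp_pos y) as Hy; rewrite exp_Ropp.
  assert (H : exp y * / exp y = 1) by (field; lra).
  assert (0 < / exp y) by (apply Rinv_0_lt_compat, Hy).
  pose proof (pow2_ge_0 (exp y - / exp y)); nra.
Qed.

Lemma Ccos_re (z : C) : Re (Ccos z) = (exp (Im z) + exp (- Im z)) / 2 * cos (Re z).
Proof.
  destruct z as [x y]; unfold Ccos.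
  transitivity (/ 2 * (Re (Cexp (Ci * (x, y))) + Re (Cexp (- (Ci * (x, y)))))).
  { replace (((Cexp (Ci * (x, y)) + Cexp (- (Ci * (x, y)))) / 2)%C)
      with (RtoC (/ 2) * (Cexp (Ci * (x, y)) + Cexp (- (Ci * (x, y)))))%C.
    - now rewrite Re_scal.
    - rewrite RtoC_inv by lra; unfold Cdiv; ring. }
  unfold Cexp; simpl.
  replace (0 * x - 1 * y) with (- y) by ring; replace (0 * y + 1 * x) with x by ring.
  rewrite cos_neg, Ropp_involutive; field.
Qed.

Lemma Csin_re (z : C) : Re (Csin z) = (exp (Im z) + exp (- Im z)) / 2 * sin (Re z).
Proof.
  destruct z as [x y]; rewrite Csin_alt.
  transitivity (/ 2 * (Im (Cexp (Ci * (x, y))) - Im (Cexp (- (Ci * (x, y)))))).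
  { replace (- Ci * (Cexp (Ci * (x, y)) - Cexp (- (Ci * (x, y)))) / 2)%C
      with (RtoC (/ 2) * (- Ci * (Cexp (Ci * (x, y)) - Cexp (- (Ci * (x, y))))))%C.
    - rewrite Re_scal; simpl; ring.
    - rewrite RtoC_inv by lra; unfold Cdiv; ring. }
  unfold Cexp; simpl.
  replace (0 * x - 1 * y) with (- y) by ring; replace (0 * y + 1 * x) with x by ring.
  rewrite sin_neg, Ropp_involutive; field.
Qed.

(** This is (2 / sqrt 3) cos(beta + pi/6), the trigonometric solution of the cubic. *)
Definition trig_root (z : C) : C := (Ccos (beta z) - Csin (beta z) / sqrt 3)%C.

Lemma RtoC_sqrt3 : (RtoC (sqrt 3) * RtoC (sqrt 3))%C = 3%C /\ RtoC (sqrt 3) <> 0%C.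
Proof.
  destruct sqrt3_facts as [Hs Hs0]; split.
  - now rewrite <- RtoC_mult, Hs.
  - intros H; injection H; lra.
Qed.

Lemma disc_arcsin (z : C) : disc z -> Cmod (3 * z * sqrt 3 / 2) < 1.
Proof.
  unfold disc; intros Hz; rewrite Cmod_div by (intros H; injection H; lra).
  destruct sqrt3_facts as [_ Hs0].
  rewrite !Cmod_mult, !Cmod_R, !Rabs_pos_eq by lra; lra.
Qed.

Lemma trig_root_cubic (z : C) : disc z -> (trig_root z - trig_root z ^ 3)%C = z.
Proof.
  intros Hz; pose proof (Csin_triple_arcsin _ (disc_arcsin z Hz)) as H3.
  pose proof (Ccos_Csin_sqr (beta z)) as Hcs.
  destruct RtoC_sqrt3 as [Hs Hs0].
  unfold trig_root; fold (beta z) in H3.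
  set (c := Ccos (beta z)) in *; set (s := Csin (beta z)) in *; set (q := RtoC (sqrt 3)) in *.
  assert (Hq : (/ q = q / 3)%C).
  { rewrite <- Hs; field; exact Hs0. }
  unfold Cdiv at 1 2; rewrite Hq.
  (* Modulo c^2 + s^2 = 1 and q^2 = 3 only 2/9 q (3 s - 4 s^3) remains, and 3 s - 4 s^3 = 3 z q /
     2. *)
  transitivity (c * (1 - (c ^ 2 + s ^ 2)) + q * s * (c ^ 2 + s ^ 2 - 1)
    + 2 / 9 * q * (3 * s - 4 * s ^ 3)
    + c * s ^ 2 * (1 - q * q / 3) + q / 27 * (q * q - 3) * s ^ 3)%C; [field|].
  rewrite Hcs, H3; transitivity (q * q * z / 3 + c * s ^ 2 * (1 - q * q / 3)
    + q / 27 * (q * q - 3) * s ^ 3)%C; [field|].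
  rewrite Hs; field.
Qed.

(** The real part is cosh(Im beta) (2 / sqrt 3) cos(Re beta + pi/6). Since Re beta is a third of an
    argument in (-pi/2, pi/2), the angle lies in (0, pi/3) and its cosine exceeds 1/2. *)
Lemma trig_root_right (z : C) : disc z -> right_of_critical (trig_root z).
Proof.
  intros Hz; pose proof (arcsin_arg_re _ (disc_arcsin z Hz)) as Hre.
  apply Carg_right in Hre; set (w := arcsin_arg _) in Hre.
  assert (Hb : Re (beta z) = Carg w / 3).
  { unfold beta; rewrite <- RtoC_inv by lra; rewrite Re_scal.
    change (Carcsin (3 * z * sqrt 3 / 2)) with (- (Ci * Clog w))%C.
    unfold Clog; simpl; field. }
  unfold right_of_critical, trig_root; destruct sqrt3_facts as [Hs Hs0].
  assert (E : Re (Ccos (beta z) - Csin (beta z) / sqrt 3)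
    = (exp (Im (beta z)) + exp (- Im (beta z))) / 2
      * (2 / sqrt 3 * cos (Carg w / 3 + PI / 6))).
  { replace (Ccos (beta z) - Csin (beta z) / sqrt 3)%C
      with (Ccos (beta z) + RtoC (- / sqrt 3) * Csin (beta z))%C.
    2: { rewrite RtoC_opp, RtoC_inv by lra; unfold Cdiv; ring. }
    change (Re (Ccos (beta z) + RtoC (- / sqrt 3) * Csin (beta z)))
      with (Re (Ccos (beta z)) + Re (RtoC (- / sqrt 3) * Csin (beta z))).
    rewrite Re_scal, Ccos_re, Csin_re, Hb, cos_plus, cos_PI6, sin_PI6.
    field; lra. }
  rewrite E; pose proof (cosh_ge_1 (Im (beta z))) as Hch.
  pose proof PI_RGT_0.
  assert (Hcos : 1 / 2 < cos (Carg w / 3 + PI / 6)).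
  { rewrite <- cos_PI3; apply cos_decreasing_1; lra. }
  assert (0 < / sqrt 3) by (apply Rinv_0_lt_compat, Hs0).
  unfold Rdiv at 1; rewrite Rmult_1_l.
  apply Rlt_le_trans with (2 / sqrt 3 * cos (Carg w / 3 + PI / 6)).
  - replace (/ sqrt 3) with (2 / sqrt 3 * (1 / 2)) at 1 by (field; lra).
    apply Rmult_lt_compat_l; [unfold Rdiv; lra|exact Hcos].
  - rewrite <- (Rmult_1_l (2 / sqrt 3 * _)) at 1; apply Rmult_le_compat_r; [|lra].
    apply Rmult_le_pos; [unfold Rdiv|]; lra.
Qed.

(** * Identification of the roots and closed forms *)

Lemma B_sum_trig (z : C) : disc z -> B_sum (- (1 / 2)) z = trig_root z.
Proof.
  intros Hz; apply cubic_unique.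
  - now apply B_sum_right.
  - now apply trig_root_right.
  - now rewrite B_sum_cubic.
  - now rewrite B_sum_cubic, trig_root_cubic.
Qed.

(** As sqrt 3 cos beta - sin beta = sqrt 3 U, the base is 3 / (3 U^2) = U^(-2) = B. *)
Lemma power_base_exp (z : C) : disc z -> Cexp (logB z) = power_base z.
Proof.
  intros Hz; destruct RtoC_sqrt3 as [Hs Hs0].
  assert (H1 : Cexp (logB z) = B_sum 1 z).
  { rewrite B_sum_exp by exact Hz; f_equal; ring. }
  assert (H2 : (B_sum 1 z * trig_root z ^ 2)%C = 1%C).
  { rewrite <- B_sum_trig, <- (B_sum_0 z) by exact Hz.
    replace 0 with (1 + (- (1 / 2) + - (1 / 2))) by field.
    rewrite <- !B_sum_mult by exact Hz; ring. }
  assert (H3 : (sqrt 3 * Ccos (beta z) - Csin (beta z))%C = (sqrt 3 * trig_root z)%C).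
  { unfold trig_root; field; exact Hs0. }
  assert (Hv : trig_root z <> 0%C).
  { intros H; rewrite H in H2; apply C1_nz; rewrite <- H2; ring. }
  unfold power_base; rewrite H1, H3, <- (Cmult_1_r (B_sum 1 z)), <- Hs.
  transitivity (B_sum 1 z * trig_root z ^ 2 / trig_root z ^ 2)%C; [field; exact Hv|].
  rewrite H2; field; auto.
Qed.

(** In D_0 (3 U^2 - 1) = 2 the second factor equals 2 c (c - q s), by q^2 = 3 and c^2 + s^2 = 1. The
    equation itself shows that this denominator is not zero. *)
Lemma D_sum_0_trig (z : C) :
  disc z ->
  D_sum 0 z = (1 / (Ccos (beta z) * (Ccos (beta z) - sqrt 3 * Csin (beta z))))%C.
Proof.
  intros Hz; pose proof (D_sum_0 z Hz) as H; rewrite B_sum_trig in H by exact Hz.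
  destruct RtoC_sqrt3 as [Hs Hs0]; pose proof (Ccos_Csin_sqr (beta z)) as Hcs.
  unfold trig_root in H; set (c := Ccos (beta z)) in *; set (s := Csin (beta z)) in *.
  set (q := RtoC (sqrt 3)) in *.
  assert (E : (3 * (c - s / q) ^ 2 - 1 = 2 * (c * (c - q * s)))%C).
  { rewrite <- Hcs; transitivity (q * q * (c - s / q) ^ 2 - (c ^ 2 + s ^ 2))%C;
      [now rewrite Hs|].
    transitivity ((q * q - 3) * c ^ 2 + 2 * (c * (c - q * s)))%C;
      [field; exact Hs0|rewrite Hs; ring]. }
  rewrite E in H.
  assert (E2 : (D_sum 0 z * (c * (c - q * s)))%C = 1%C).
  { transitivity (D_sum 0 z * (2 * (c * (c - q * s))) / 2)%C; [field|rewrite H; field]. }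
  assert (Hne : (c * (c - q * s))%C <> 0%C).
  { intros H0; rewrite H0 in E2; apply C1_nz; rewrite <- E2; ring. }
  apply Cmult_eq_reg_l with (1 := Hne); unfold Cdiv.
  transitivity (D_sum 0 z * (c * (c - q * s)))%C; [ring|].
  rewrite E2, <- (Cinv_r _ Hne) at 1; ring.
Qed.

(** * Uniqueness of the branch of the logarithm *)

Lemma Cexp_eq_1 (z : C) : Cexp z = 1%C -> Re z = 0 /\ cos (Im z) = 1 /\ sin (Im z) = 0.
Proof.
  unfold Cexp; intros H; injection H; intros H2 H1; clear H.
  pose proof (exp_pos (Re z)) as He; pose proof (sin2_cos2 (Im z)) as Hsc.
  unfold Rsqr in Hsc.
  assert (Hs : sin (Im z) = 0) by nra.
  assert (Hc : exp (Re z) = 1).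
  { rewrite Hs in Hsc.
    assert (exp (Re z) * exp (Re z) = 1); [|nra].
    transitivity ((exp (Re z) * cos (Im z)) * (exp (Re z) * cos (Im z))); [|rewrite H1; ring].
    transitivity (exp (Re z) * exp (Re z) * (0 * 0 + cos (Im z) * cos (Im z)));
      [rewrite Hsc|]; ring. }
  split; [|split; [rewrite Hc in H1; lra|exact Hs]].
  apply exp_inv; now rewrite exp_0.
Qed.

(** If f 1 were positive, f would take the value min(f 1, 1) / 2, which lies in (0, pi), where the
    sine is positive. Applied to f and to -f, this shows that the path ends where it starts. *)
Lemma sin_zero_path (f : R -> R) :
  (forall t, 0 <= t <= 1 -> continuity_pt f t) ->
  (forall t, 0 <= t <= 1 -> sin (f t) = 0) -> f 0 = 0 -> f 1 <= 0.
Proof.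
  intros Hc Hs H0; destruct (Rle_or_lt (f 1) 0) as [|H1]; [assumption|exfalso].
  pose proof (Rmin_l (f 1) 1); pose proof (Rmin_r (f 1) 1).
  assert (0 < Rmin (f 1) 1) by (apply Rmin_pos; lra).
  set (k := Rmin (f 1) 1 / 2).
  destruct (IVT_interv (fun t => f t - k) 0 1) as [t [Ht Hft]].
  - intros t Ht; apply continuity_pt_minus; [now apply Hc|].
    apply continuity_pt_const; now intros ??.
  - lra.
  - unfold k; lra.
  - unfold k; lra.
  - pose proof (Hs t Ht) as E; replace (f t) with k in E by lra.
    assert (0 < sin k); [|lra].
    pose proof PI2_1; apply sin_gt_0; unfold k; lra.
Qed.

Lemma ray_continuity (L : C -> C) (z : C) (t : R) :
  ex_derive (K := C_AbsRing) (V := C_NormedModule) L (t * z)%C ->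
  continuity_pt (fun s : R => Im (L (s * z)%C)) t.
Proof.
  intros H; apply ex_derive_continuous in H.
  apply continuity_pt_filterlim, filterlim_locally; intros eps.
  destruct (proj1 (filterlim_locally _ _) H eps) as [d Hd].
  pose proof (Cmod_ge_0 z) as Hz.
  assert (Hp : 0 < d / (Cmod z + 1)) by (apply Rdiv_lt_0_compat; [apply cond_pos|lra]).
  exists (mkposreal _ Hp); intros s Hs.
  apply Hd; change (Cmod (s * z - t * z) < d).
  change (Rabs (s - t) < d / (Cmod z + 1)) in Hs.
  replace (s * z - t * z)%C with ((s - t)%R * z)%C by (rewrite RtoC_minus; ring).
  rewrite Cmod_mult, Cmod_R.
  apply Rle_lt_trans with (Rabs (s - t) * (Cmod z + 1)).
  - apply Rmult_le_compat_l; [apply Rabs_pos|lra].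
  - apply Rlt_le_trans with (d / (Cmod z + 1) * (Cmod z + 1)); [|right; field; lra].
    apply Rmult_lt_compat_r; lra.
Qed.

(* L - log B takes values in the discrete set 2 pi i Z, hence is constant on rays. *)
Lemma log_branch_unique (L : C -> C) (z : C) :
  holomorphic_on disc L -> (forall w, disc w -> Cexp (L w) = power_base w) ->
  disc z -> L z = (logB z + L 0)%C.
Proof.
  intros HL HE Hz.
  set (M := fun t : R => (L (t * z) + - logB (t * z))%C).
  assert (HM : forall t, 0 <= t <= 1 -> Cexp (M t) = 1%C).
  { intros t Ht; unfold M; rewrite Cexp_plus, HE, <- power_base_exp
      by now apply disc_scal.
    apply Cexp_mul_opp. }
  assert (HM0 : M 0 = L 0%C).
  { unfold M; replace (RtoC 0 * z)%C with (RtoC 0) by ring.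
    rewrite csum_0; simpl; ring. }
  assert (HM1 : M 1 = (L z + - logB z)%C).
  { unfold M; now replace (RtoC 1 * z)%C with z by ring. }
  (* The real part of M is 0 throughout, so only the imaginary part has to be followed; the
     subtraction makes the path start at 0. *)
  set (f := fun t => Im (M t) - Im (M 0)).
  assert (Hf : forall t, 0 <= t <= 1 -> continuity_pt f t).
  { intros t Ht; apply continuity_pt_minus; [|apply continuity_pt_const; now intros ??].
    apply continuity_pt_plus; [|apply continuity_pt_opp];
      apply ray_continuity; [apply HL|apply logB_holomorphic]; now apply disc_scal. }
  assert (Hs : forall t, 0 <= t <= 1 -> sin (f t) = 0).
  { intros t Ht; unfold f; rewrite sin_minus.
    destruct (Cexp_eq_1 _ (HM t Ht)) as (_ & _ & ->).
    destruct (Cexp_eq_1 (M 0) (HM 0 ltac:(lra))) as (_ & _ & ->); ring. }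
  assert (Hf0 : f 0 = 0) by (unfold f; ring).
  assert (H1 := sin_zero_path f Hf Hs Hf0).
  assert (H2 : - f 1 <= 0).
  { apply (sin_zero_path (fun t => - f t)); [| |lra]; intros t Ht.
    - now apply continuity_pt_opp, Hf.
    - rewrite sin_neg, Hs by exact Ht; ring. }
  assert (E : M 1 = M 0).
  { apply Ceq; [|unfold f in *; lra].
    destruct (Cexp_eq_1 _ (HM 0 ltac:(lra))) as (-> & _).
    now destruct (Cexp_eq_1 _ (HM 1 ltac:(lra))) as (-> & _). }
  rewrite <- HM0, <- E, HM1; ring.
Qed.

Lemma pow_n_Cpow (z : C) (n : nat) : pow_n (K := C_Ring) z n = (z ^ n)%C.
Proof. induction n as [|n IH]; [reflexivity|simpl; now rewrite IH]. Qed.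

(* The first conjunct says that the branch of the power equal to 1 at 0
   exists, so that the second one is not vacuous. *)
Theorem corollary2p9 :
  forall r : R,
    (exists P : C -> C, power_branch disc power_base r P /\ P 0%C = 1%C) /\
    (forall P : C -> C, power_branch disc power_base r P -> P 0%C = 1%C ->
       forall z : C, 3 * Cmod z * sqrt 3 < 2 ->
         is_D (3 / 2) r z
           (P z * (1 / (Ccos (beta z) *
                        (Ccos (beta z) - sqrt 3 * Csin (beta z)))))%C).
Proof.
  intros r; split.
  - exists (fun z => Cexp (r * logB z)%C); split.
    + exists logB; split; [exact logB_holomorphic|]; split; [exact power_base_exp|].
      reflexivity.
    + rewrite csum_0, <- Cexp_0; f_equal; simpl; ring.
  - intros P (L & HL & HE & HP) HP0 z Hz; change (disc z) in Hz.
    assert (H0 : disc 0%C) by (unfold disc; rewrite Cmod_0; lra).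
    (* L 0 may be a nonzero multiple of 2 pi i; the normalisation P 0 = 1 says exp(r L 0) = 1, which
       removes it. *)
    assert (HPz : P z = B_sum r z).
    { rewrite B_sum_exp, HP, (log_branch_unique L z HL HE Hz) by exact Hz.
      replace (r * (logB z + L 0))%C with (r * logB z + r * L 0)%C by ring.
      rewrite Cexp_plus, <- (HP _ H0), HP0; ring. }
    rewrite HPz, <- D_sum_0_trig, Cmult_comm, <- D_sum_mult, Rplus_0_l by exact Hz.
    unfold is_D, is_pseries.
    apply is_Cseries_ext with (2 := csum_correct _ z (D_coef_tame r) Hz).
    intros n; rewrite <- pow_n_Cpow; apply Cmult_comm.
Qed.
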